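(* Let $H_0$ be a Hilbert space, $w\in\mathcal{B}(H_0)$ a unitary, and $\mathcal{A}\subseteq\mathcal{B}(H_0)$ a unital w*-closed subalgebra with $w\mathcal{A}w^*\subseteq\mathcal{A}$. If $\mathcal{A}$ is a reflexive algebra, then the w*-semicrossed product $\mathbb{Z}_+\overline{\times}_w\mathcal{A}$ is reflexive. In addition, if $\mathcal{A}$ is hereditarily reflexive, then every $G$-invariant w*-closed subspace of $\mathbb{Z}_+\overline{\times}_w\mathcal{A}$ is reflexive.
   Context: Let $H=H_0\otimes\ell^2(\mathbb{Z}_+)$, $\mathbb{Z}_+=\{0,1,2,\dots\}$, let $(e_n)_{n\ge0}$ be the standard basis of $\ell^2(\mathbb{Z}_+)$ and $v$ the unilateral shift $ve_n=e_{n+1}$. For $b\in\mathcal{A}$ put $\rho(b)=b\otimes 1_{\ell^2(\mathbb{Z}_+)}$, and put $W=w^*\otimes v$. The w*-semicrossed product $\mathbb{Z}_+\overline{\times}_w\mathcal{A}\subseteq\mathcal{B}(H)$ is the w*-closure of the linear space of all `analytic polynomials' $\sum_{n=0}^kW^n\rho(b_n)$, $b_n\in\mathcal{A}$, $k\ge0$. (Here $\beta(b)=wbw^*$ is the endomorphism of $\mathcal{A}$ implemented by $w$.) Reflexivity: for a subspace $\mathcal{S}\subseteq\mathcal{B}(L)$, $L$ a Hilbert space, $\mathrm{Ref}(\mathcal{S})=\{T\in\mathcal{B}(L): T\xi\in\overline{\mathcal{S}\xi}\text{ for all }\xi\in L\}$; $\mathcal{S}$ is reflexive if $\mathcal{S}=\mathrm{Ref}(\mathcal{S})$.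 A w*-closed subspace $\mathcal{S}$ is hereditarily reflexive if every w*-closed subspace of $\mathcal{S}$ is reflexive. Fourier coefficients: for $s\in\mathbb{R}$ let $U_s\in\mathcal{B}(H)$ be the unitary $U_s(\xi\otimes e_n)=e^{ins}\xi\otimes e_n$, and for $T\in\mathcal{B}(H)$, $m\in\mathbb{Z}$, let $G_m(T)=\int_0^{2\pi}U_sTU_s^*e^{-ims}\frac{ds}{2\pi}$ (w*-limit of Riemann sums). A w*-closed subspace $\mathcal{S}\subseteq\mathcal{B}(H)$ is $G$-invariant if $G_m(\mathcal{S})\subseteq\mathcal{S}$ for every $m\in\mathbb{Z}$. *)

(* Defs.v *)
From HB Require Import structures.
From mathcomp Require Import all_boot all_order all_algebra sesquilinear.
From mathcomp Require Import complex.
From mathcomp Require Import all_classical all_reals topology normedtype.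
From mathcomp Require Import sequences trigo.
From mathcomp Require Import ring lra.

Set Implicit Arguments.
Unset Strict Implicit.
Unset Printing Implicit Defensive.

Import Order.TTheory GRing.Theory Num.Theory numFieldNormedType.Exports.

Local Open Scope classical_set_scope.
Local Open Scope ring_scope.
Local Open Scope complex_scope.

Local Notation conjC := Num.conj.

(* Inner products are linear in the first variable. *)
HB.mixin Record CompleteNormedModule_isHilbert (R : realType) H
    & CompleteNormedModule R[i] H := {
  inner : {dot H for @conjC R[i]} ;
  normr_inner : forall x : H, `|x| ^+ 2 = inner x x
}.

#[short(type="hilbertType")]
HB.structure Definition Hilbert (R : realType) :=
  {H of CompleteNormedModule R[i] H & CompleteNormedModule_isHilbert R H}.

Section DotNorm.
Variables (R : realType) (U : lmodType R[i]).
Variable form : {dot U for @conjC R[i]}.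
Local Notation "''[' u , v ]" := (form u v) : ring_scope.
Local Notation "''[' u ]" := (form u u) : ring_scope.

Definition dnorm (u : U) : R[i] := sqrtC '[u].

Lemma dnorm_form_ge0 u : 0 <= dnorm u.
Proof. exact: sqrt_dnorm_ge0. Qed.

Lemma dot_conj u v : '[v, u] = conjC '[u, v].
Proof. by rewrite hermC mul1r. Qed.

Lemma dot_CauchySchwarz u v : `|'[u, v]| <= dnorm u * dnorm v.
Proof.
rewrite -ler_sqr ?nnegrE ?mulr_ge0 ?dnorm_form_ge0// exprMn !sqrtCK.
have [->|v0] := eqVneq v 0; first by rewrite !linear0r normr0 expr0n mulr0.
have vp : 0 < '[v] by rewrite dnorm_gt0.
pose c := '[u, v] / '[v].
have := dnorm_ge0 form (u - c *: v).
rewrite dnormB dnormZ linearZr_LR /=.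
have -> : conjC c * '[u, v] = `|'[u, v]| ^+ 2 / '[v].
  rewrite /c rmorphM /= fmorphV /= -(dot_conj v v) mulrAC normCK.
  by rewrite [conjC _ * _]mulrC.
rewrite rmorphM fmorphV /= -(dot_conj v v).
have -> : conjC (`|'[u, v]| ^+ 2) = `|'[u, v]| ^+ 2.
  by apply/CrealP; rewrite rpredX// normr_real.
have -> : `|c| ^+ 2 * '[v] = `|'[u, v]| ^+ 2 / '[v].
  rewrite /c normrM normfV exprMn (ger0_norm (ltW vp)) -mulrA.
  by congr (_ * _); rewrite expr2 -mulrA mulVf ?mulr1// gt_eqF.
rewrite opprD addrA addrK subr_ge0 ler_pdivrMr//.
Qed.

Lemma dnormD_le u v : dnorm (u + v) <= dnorm u + dnorm v.
Proof.
rewrite -ler_sqr ?nnegrE ?addr_ge0 ?dnorm_form_ge0// sqrrD !sqrtCK dnormD.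
rewrite [leRHS]addrAC lerD2l.
have uv := dot_CauchySchwarz u v.
have /le_trans -> // : '[u, v] + conjC '[u, v] <= `|'[u, v]| *+ 2.
  have -> : '[u, v] + conjC '[u, v] = 'Re '[u, v] *+ 2.
    by rewrite ReE -mulr_natr mulfVK// pnatr_eq0.
  by rewrite lerMn2r /=; case: (leif_Re_Creal '[u, v]) => ->.
by rewrite lerMn2r.
Qed.

Lemma dnorm_homo (a : R[i]) u : dnorm (a *: u) = `|a| * dnorm u.
Proof.
by rewrite /dnorm dnormZ sqrtCM ?nnegrE ?exprn_ge0 ?dnorm_ge0// sqrCK.
Qed.

Lemma dnorm_form_eq0 u : dnorm u = 0 -> u = 0.
Proof. by move/eqP; rewrite sqrt_dnorm_eq0 => /eqP. Qed.

End DotNorm.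
Section RealNorm.
Variables (R : realType) (V : normedModType R[i]).
Implicit Types x y : V.

(* The norm of [V] as a real number; the library's norm lives in [R[i]]. *)
Definition rnorm (x : V) : R := complex.Re `|x|.

Lemma rnormE x : `|x| = (rnorm x)%:C.
Proof. by rewrite /rnorm RRe_real// normr_real. Qed.

Lemma rnorm_ge0 x : 0 <= rnorm x.
Proof. by rewrite -lecR -rnormE normr_ge0. Qed.

Lemma rnormD x y : rnorm (x + y) <= rnorm x + rnorm y.
Proof. by rewrite -lecR rmorphD /= -!rnormE ler_normD. Qed.

Lemma rnormB x y : rnorm (x - y) = rnorm (y - x).
Proof. by rewrite /rnorm distrC. Qed.

Lemma rnormZ a x : rnorm (a *: x) = complex.Re `|a| * rnorm x.
Proof.
apply: complexI; rewrite [RHS]rmorphM /= -!rnormE normrZ; congr (_ * _).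
Qed.

Lemma rnorm0 : rnorm 0 = 0.
Proof. by rewrite /rnorm normr0. Qed.

Lemma rnorm_eq0 x : rnorm x = 0 -> x = 0.
Proof. by move=> x0; apply/normr0_eq0; rewrite rnormE x0. Qed.

End RealNorm.

Section SquareSummable.
Variables (R : realType) (H : hilbertType R).
Implicit Types f g : nat -> H.

Definition sq_summable f := cvgn (series (fun n => rnorm (f n) ^+ 2)).

Lemma series_nneg_cvg (u : nat -> R) (M : R) : (forall n, 0 <= u n) ->
  (forall n, series u n <= M) -> cvgn (series u).
Proof.
move=> u0 uM; apply: nondecreasing_is_cvgn.
  by apply: nondecreasing_series => n _ _; exact: u0.
by exists M => _ [n _ <-].
Qed.

Lemma series_nneg_le (u : nat -> R) : (forall n, 0 <= u n) ->
  cvgn (series u) -> forall n, series u n <= limn (series u).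
Proof.
move=> u0 cu n; apply: nondecreasing_cvgn_le => //.
by apply: nondecreasing_series => k _ _; exact: u0.
Qed.

Lemma sq_summable_submod :
  GRing.subsemimod_closed (fun f : nat -> H => `[< sq_summable f >]).
Proof.
have sqN (x : H) : 0 <= rnorm x ^+ 2 by rewrite sqr_ge0.
split; [split|].
- apply/asboolP; apply: (@series_nneg_cvg _ 0) => // n.
  by rewrite seriesEnat /= big1// => i _; rewrite rnorm0 expr0n.
- move=> f g /asboolP cf /asboolP cg; apply/asboolP.
  apply: (@series_le_cvg _ _ ((fun n => 2 * rnorm (f n) ^+ 2) +
      (fun n => 2 * rnorm (g n) ^+ 2))) => [//|n|n|].
  + by rewrite addr_ge0// mulr_ge0.
  + rewrite (@le_trans _ _ ((rnorm (f n) + rnorm (g n)) ^+ 2))//.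
      by rewrite ler_sqr ?nnegrE ?addr_ge0 ?rnorm_ge0// rnormD.
    have ab2 (a b : R) : (a + b) ^+ 2 <= 2 * a ^+ 2 + 2 * b ^+ 2.
      have := sqr_ge0 (a - b); nra.
    exact: ab2.
  + by apply: is_cvg_seriesD; apply: is_cvg_seriesZ.
- move=> a f /asboolP cf; apply/asboolP.
  rewrite /sq_summable (_ : (fun n => _) =
      (complex.Re `|a| ^+ 2) *: (fun n => rnorm (f n) ^+ 2)).
    exact: is_cvg_seriesZ.
  by apply/funext => n; rewrite rnormZ exprMn.
Qed.

End SquareSummable.

(* [ell2 H] is the Hilbert space of square-summable sequences in [H]; it is *)
(* the tensor product of [H] with the sequence space over the naturals.     *)
Record ell2 (R : realType) (H : hilbertType R) := Ell2 {
  ell2_val :> nat -> H ;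
  ell2_summable : `[< sq_summable ell2_val >]
}.

Section Ell2.
Variables (R : realType) (H : hilbertType R).

HB.instance Definition _ := [isSub for @ell2_val R H].
HB.instance Definition _ := [Choice of ell2 H by <:].
HB.instance Definition _ := GRing.SubChoice_isSubLmodule.Build
  R[i] (nat -> H) (fun f => `[< sq_summable f >]) (ell2 H)
  (@sq_summable_submod R H).

Implicit Types x y : ell2 H.

Lemma ell2P x : sq_summable x.
Proof. exact/asboolP/ell2_summable. Qed.
Arguments ell2P : clear implicits.

Lemma ell2_eqP x y : (forall n, x n = y n) -> x = y.
Proof. by move=> xy; apply/val_inj/funext. Qed.

Lemma ell2D x y n : (x + y) n = x n + y n.
Proof. by []. Qed.

Lemma ell2Z (a : R[i]) x n : (a *: x) n = a *: x n.
Proof. by []. Qed.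

Lemma ell2N x n : (- x) n = - x n.
Proof. by []. Qed.


Lemma inner_CauchySchwarz (u v : H) : `|inner u v| <= `|u| * `|v|.
Proof.
have nE (z : H) : dnorm inner z = `|z| by rewrite /dnorm -normr_inner sqrCK.
by rewrite -!nE; exact: dot_CauchySchwarz.
Qed.

Lemma ReIm_le (u v : H) :
  `|complex.Re (inner u v)| <= rnorm u ^+ 2 + rnorm v ^+ 2 /\
  `|complex.Im (inner u v)| <= rnorm u ^+ 2 + rnorm v ^+ 2.
Proof.
have uv : complex.Re `|inner u v| <= rnorm u ^+ 2 + rnorm v ^+ 2.
  have := inner_CauchySchwarz u v; rewrite !rnormE -rmorphM /= lecE /=.
  move=> /andP[_ /le_trans]; apply.
  have := sqr_ge0 (rnorm u - rnorm v).
  have := sqr_ge0 (rnorm u + rnorm v); nra.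
split; apply: le_trans uv; rewrite -lecR.
  by apply: le_trans (normc_ge_Re _) _; rewrite lecE /= eqxx lexx.
rewrite -normrN -ReiNIm; apply: le_trans (normc_ge_Re _) _.
rewrite normrM (_ : `|'i| = 1) ?mulr1; first by rewrite lecE /= eqxx lexx.
by rewrite normc_def /= expr0n expr1n add0r sqrtr1.
Qed.

Lemma ell2_inner_cvg x y :
  cvgn (series (fun n => complex.Re (inner (x n) (y n)))) /\
  cvgn (series (fun n => complex.Im (inner (x n) (y n)))).
Proof.
have s0 n : 0 <= rnorm (x n) ^+ 2 + rnorm (y n) ^+ 2.
  by rewrite addr_ge0// sqr_ge0.
have := is_cvg_seriesD (ell2P x) (ell2P y) => cxy.
split; apply: normed_cvg; apply: series_le_cvg cxy => n.
- exact: normr_ge0.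
- exact: s0.
- by case: (ReIm_le (x n) (y n)).
- exact: normr_ge0.
- exact: s0.
- by case: (ReIm_le (x n) (y n)).
Qed.

Definition ell2_inner x y : R[i] :=
  limn (series (fun n => complex.Re (inner (x n) (y n)))) +i*
  limn (series (fun n => complex.Im (inner (x n) (y n)))).

Lemma ell2_innerDl x x' y :
  ell2_inner (x + x') y = ell2_inner x y + ell2_inner x' y.
Proof.
have [cr ci] := ell2_inner_cvg x y; have [cr' ci'] := ell2_inner_cvg x' y.
rewrite /ell2_inner [RHS]/(_ + _)/= -!lim_seriesD//.
have e n : inner ((x + x') n) (y n) = inner (x n) (y n) + inner (x' n) (y n).
  exact: linearDl.
by congr (limn (series _) +i* limn (series _)); apply/funext => n;
  rewrite e [RHS]/(_ + _)/=; case: (inner (x n) (y n)) => ? ?;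
  case: (inner (x' n) (y n)).
Qed.

Lemma ell2_innerZl (a : R[i]) x y :
  ell2_inner (a *: x) y = a * ell2_inner x y.
Proof.
have [cr ci] := ell2_inner_cvg x y.
have lZ (k : R) f : cvgn (series f) ->
    k * limn (series f) = limn (series (k *: f)).
  by move=> cf; rewrite lim_seriesZ.
case: a => a b; rewrite /ell2_inner [RHS]/(_ * _)/= !lZ//.
rewrite -lim_seriesB; [|exact: is_cvg_seriesZ|exact: is_cvg_seriesZ].
rewrite -lim_seriesD; [|exact: is_cvg_seriesZ|exact: is_cvg_seriesZ].
have e n : inner (((a +i* b) *: x) n) (y n) = (a +i* b) * inner (x n) (y n).
  exact: linearZl_LR.
congr (limn (series _) +i* limn (series _)); apply/funext => n; rewrite e.
  rewrite [RHS](_ : _ = a * complex.Re (inner (x n) (y n)) -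
    b * complex.Im (inner (x n) (y n)))//; by case: (inner (x n) (y n)).
rewrite [RHS](_ : _ = a * complex.Im (inner (x n) (y n)) +
  b * complex.Re (inner (x n) (y n)))//; by case: (inner (x n) (y n)).
Qed.

Lemma ell2_inner_conj x y : ell2_inner y x = conjC (ell2_inner x y).
Proof.
have [cr ci] := ell2_inner_cvg x y.
rewrite /ell2_inner [RHS]/(conjC _)/= -lim_seriesN//.
congr (limn (series _) +i* limn (series _)); apply/funext => n;
  rewrite (dot_conj _ (x n) (y n)); first by case: (inner (x n) (y n)).
rewrite [RHS](_ : _ = - complex.Im (inner (x n) (y n)))//.
by case: (inner (x n) (y n)).
Qed.

Lemma ell2_innerxx x :
  ell2_inner x x = (limn (series (fun n => rnorm (x n) ^+ 2)))%:C.
Proof.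
have xx n : inner (x n) (x n) = (rnorm (x n) ^+ 2)%:C.
  by rewrite -normr_inner rnormE -rmorphXn.
rewrite /ell2_inner; congr (_ +i* _).
  by congr (limn (series _)); apply/funext => n; rewrite xx.
rewrite (_ : series _ = fun=> 0) ?lim_cst//.
by apply/funext => n; rewrite seriesEnat /= big1// => i _; rewrite xx.
Qed.

Lemma ell2_innerDr x y y' :
  ell2_inner x (y + y') = ell2_inner x y + ell2_inner x y'.
Proof.
rewrite ell2_inner_conj ell2_innerDl (ell2_inner_conj y) (ell2_inner_conj y').
exact: rmorphD.
Qed.

Lemma ell2_innerZr (a : R[i]) x y :
  ell2_inner x (a *: y) = conjC a * ell2_inner x y.
Proof. by rewrite ell2_inner_conj ell2_innerZl (ell2_inner_conj y) rmorphM. Qed.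

Lemma ell2_innerBl y : zmod_morphism (ell2_inner^~ y).
Proof. by move=> x x'; rewrite -scaleN1r ell2_innerDl ell2_innerZl mulN1r. Qed.

Lemma ell2_innerBr x : zmod_morphism (ell2_inner x).
Proof.
by move=> y y'; rewrite -scaleN1r ell2_innerDr ell2_innerZr rmorphN1 mulN1r.
Qed.

Lemma ell2_inner_herm x y :
  ell2_inner x y = (-1) ^+ false * conjC (ell2_inner y x).
Proof. by rewrite mul1r ell2_inner_conj. Qed.

Lemma ell2_inner_gt0 x : x != 0 -> 0 < ell2_inner x x.
Proof.
move=> x0; have sq0 n : 0 <= rnorm (x n) ^+ 2 by rewrite sqr_ge0.
rewrite ell2_innerxx ltcR lt_neqAle; apply/andP; split; last first.
  by have := series_nneg_le sq0 (ell2P x) 0; rewrite seriesEnat/= big_geq.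
apply: contra_neqN x0 => /eqP s0; apply: ell2_eqP => n.
apply: rnorm_eq0; apply/eqP; rewrite -sqrf_eq0 eq_le sq0 andbT.
have := series_nneg_le sq0 (ell2P x) n.+1.
rewrite -s0 seriesEnat/= big_nat_recr//=; apply: le_trans.
by rewrite lerDr sumr_ge0.
Qed.

HB.instance Definition _ := isBilinear.Build R[i] (ell2 H) (ell2 H) R[i]
  *%R (@conjC R[i] \; *%R) ell2_inner ell2_innerBl ell2_innerBr
  (fun y a x => ell2_innerZl a x y) (fun x a y => ell2_innerZr a x y).
HB.instance Definition _ := isHermitianSesquilinear.Build R[i] (ell2 H)
  false (@conjC R[i]) ell2_inner ell2_inner_herm.
HB.instance Definition _ := isDotProduct.Build R[i] (ell2 H) ell2_inner
  ell2_inner_gt0.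

Let form : {dot (ell2 H) for @conjC R[i]} := ell2_inner.

HB.instance Definition _ := Lmodule_isNormed.Build R[i] (ell2 H)
  (@dnormD_le R (ell2 H) form) (@dnorm_homo R (ell2 H) form)
  (@dnorm_form_eq0 R (ell2 H) form).

Lemma ell2_normE x : `|x| ^+ 2 = ell2_inner x x.
Proof. exact: sqrtCK. Qed.

Lemma ell2_rnormE x : rnorm x ^+ 2 = limn (series (fun n => rnorm (x n) ^+ 2)).
Proof.
by apply: complexI; rewrite [LHS]rmorphXn /= -rnormE ell2_normE ell2_innerxx.
Qed.

Lemma ell2_partial x N : \sum_(n < N) rnorm (x n) ^+ 2 <= rnorm x ^+ 2.
Proof.
rewrite ell2_rnormE -(big_mkord xpredT (fun n => rnorm (x n) ^+ 2)).
by apply: series_nneg_le (ell2P x) N => n; rewrite sqr_ge0.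
Qed.

Lemma ell2_rnorm_le x (M : R) : 0 <= M ->
  (forall N, \sum_(n < N) rnorm (x n) ^+ 2 <= M ^+ 2) -> rnorm x <= M.
Proof.
move=> M0 xM; rewrite -ler_sqr ?nnegrE ?rnorm_ge0// ell2_rnormE.
apply: limr_le; first exact: ell2P.
by apply: nearW => N; rewrite seriesEnat /= big_mkord.
Qed.

Lemma sq_summable_bounded (f : nat -> H) (M : R) :
  (forall N, \sum_(n < N) rnorm (f n) ^+ 2 <= M) -> sq_summable f.
Proof.
move=> fM; apply: (@series_nneg_cvg _ _ M) => n; first by rewrite sqr_ge0.
by rewrite seriesEnat /= big_mkord.
Qed.

Lemma ell2_coord_le x n : rnorm (x n) <= rnorm x.
Proof.
rewrite -ler_sqr ?nnegrE ?rnorm_ge0//; apply: le_trans (ell2_partial x n.+1).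
by rewrite big_ord_recr /= lerDr sumr_ge0// => i _; rewrite sqr_ge0.
Qed.

Lemma ball_rnorm (V : normedModType R[i]) (u v : V) (e : R) :
  ball u e%:C v = (rnorm (u - v) < e) :> Prop.
Proof. by rewrite -ball_normE /ball_ /= rnormE ltcR. Qed.

Lemma gt0_complex (e : R[i]) : 0 < e -> exists2 d : R, 0 < d & e = d%:C.
Proof.
case: e => d b; rewrite ltcE /= => /andP[/eqP-> d0]; by exists d.
Qed.

Lemma ell2_complete (F : set_system (ell2 H)) :
  ProperFilter F -> cauchy F -> cvg F.
Proof.
move=> FF /cauchyP Fc.
have Fcoord n : cvg ((fun x : ell2 H => x n) @ F).
  apply: cauchy_cvg; apply: cauchy_exP => e /[dup] e0 /Fc [x Fx].
  exists (x n).
  apply: (@filterS _ F _ _ _ _ Fx) => y /=; have [d d0 ->] := gt0_complex e0.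
  rewrite !ball_rnorm; apply: le_lt_trans.
  exact: (ell2_coord_le (x - y)).
pose l n := lim ((fun x : ell2 H => x n) @ F).
have dist (x : ell2 H) (e : R) : 0 < e -> F (ball x e%:C) ->
    forall N, \sum_(n < N) rnorm (x n - l n) ^+ 2 <= e ^+ 2.
  move=> e0 Fx N.
  have cv : (fun y : ell2 H => \sum_(n < N) rnorm (x n - y n) ^+ 2) @ F -->
      \sum_(n < N) rnorm (x n - l n) ^+ 2.
    apply: cvg_big => [|n _]; first by apply: add_continuous.
    have cn : (fun y : ell2 H => rnorm (x n - y n)) @ F --> rnorm (x n - l n).
      apply/cvgrPdist_lt => d d0.
      have := Fcoord n => /cvg_ball /(_ d%:C); rewrite ltcR => /(_ d0).
      apply: filterS => y; rewrite ball_rnorm; apply: le_lt_trans.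
      have := rnormD (x n - l n) (l n - y n).
      have := rnormD (x n - y n) (y n - l n).
      rewrite !addrA !subrK (rnormB (y n)) ler_norml => ? ?.
      by apply/andP; split; lra.
    by under eq_fun do rewrite expr2; apply: cvgM.
  rewrite -(cvg_lim _ cv)//; apply: limr_le.
    by apply/cvg_ex; eexists; exact: cv.
  apply: filterS Fx => y; rewrite ball_rnorm => xy.
  apply: (le_trans (ell2_partial (x - y) N)).
  by rewrite ler_sqr ?nnegrE ?rnorm_ge0// ltW.
have [x0 Fx0] : exists x, F (ball x 1%:C) by apply: Fc; rewrite ltcR.
have s0 : `[< sq_summable (fun n => x0 n - l n) >].
  by apply/asboolP/(@sq_summable_bounded _ (1 ^+ 2)); exact: dist.
pose L := x0 - Ell2 s0.
have Ln n : L n = l n by rewrite /L -[LHS]/(x0 n - (x0 n - l n)) subKr.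
apply/cvg_ex; exists L; apply/cvg_ballP => e /gt0_complex[d d0 ->].
have [x Fx] : exists x, F (ball x (d / 2)%:C).
  by apply: Fc; rewrite ltcR divr_gt0.
apply: filterS (Fx) => y; rewrite !ball_rnorm => xy.
have : rnorm (x - L) <= d / 2.
  apply: ell2_rnorm_le; first by rewrite ltW// divr_gt0.
  move=> N; under eq_bigr do rewrite -[X in rnorm X]/(x _ - L _) Ln.
  by apply: dist => //; rewrite divr_gt0.
have := rnormD (L - x) (x - y); rewrite addrA subrK (rnormB L x) => ? ?; lra.
Qed.

HB.instance Definition _ := Uniform_isComplete.Build (ell2 H) ell2_complete.
HB.instance Definition _ := CompleteNormedModule_isHilbert.Build R (ell2 H)
  ell2_normE.

End Ell2.

Definition is_bounded_linear (R : realType) (H : hilbertType R) (f : H -> H) :=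
  linear f /\ exists M : R[i], forall x, `|f x| <= M * `|x|.

(* [bop H] is the algebra of bounded operators on [H]. *)
Record bop (R : realType) (H : hilbertType R) := Bop {
  bop_val :> H -> H ;
  bop_bounded : `[< is_bounded_linear bop_val >]
}.

Section BoundedOperators.
Variables (R : realType) (H : hilbertType R).

Lemma bounded_linear_submod :
  GRing.subsemimod_closed (fun f : H -> H => `[< is_bounded_linear f >]).
Proof.
split; [split|].
- apply/asboolP; split; first by move=> a x y; rewrite scaler0 addr0.
  by exists 0 => x; rewrite mul0r normr0.
- move=> f g /asboolP[lf [M fM]] /asboolP[lg [N gN]]; apply/asboolP; split.
    move=> a x y; rewrite !fctE lf lg scalerDr -!addrA; congr (_ + _).
    by rewrite addrCA.
  by exists (M + N) => x; rewrite mulrDl (le_trans (ler_normD _ _))// lerD.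
- move=> a f /asboolP[lf [M fM]]; apply/asboolP; split.
    by move=> b x y; rewrite !fctE lf scalerDr !scalerA mulrC.
  by exists (`|a| * M) => x; rewrite normrZ -mulrA ler_wpM2l.
Qed.

HB.instance Definition _ := [isSub for @bop_val R H].
HB.instance Definition _ := [Choice of bop H by <:].
HB.instance Definition _ := GRing.SubChoice_isSubLmodule.Build
  R[i] (H -> H) (fun f => `[< is_bounded_linear f >]) (bop H)
  bounded_linear_submod.
HB.instance Definition _ := isPointed.Build (bop H) 0.

Implicit Types S T : bop H.

Lemma bopP T : is_bounded_linear T.
Proof. exact/asboolP/bop_bounded. Qed.

Lemma bop_eqP S T : (forall x, S x = T x) -> S = T.
Proof. by move=> ST; apply/val_inj/funext. Qed.

Lemma bop_linear T : linear T.
Proof. by case: (bopP T). Qed.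

HB.instance Definition _ T := GRing.isLinear.Build R[i] H H *:%R T
  (bop_linear T).

Lemma bop_ge0_bound T :
  exists2 M : R, 0 <= M & forall x, rnorm (T x) <= M * rnorm x.
Proof.
have [_ [M TM]] := bopP T.
have [m mE] : exists m : R, `|M| = m%:C.
  by exists (complex.Re `|M|); rewrite RRe_real ?normr_real.
exists m; first by rewrite -lecR -mE; exact: normr_ge0.
move=> x; rewrite -lecR rmorphM /= -!rnormE -mE -(normr_id x) -normrM.
by rewrite ger0_norm//; exact: le_trans (TM x).
Qed.

Lemma bop1_subproof : `[< is_bounded_linear (@idfun H) >].
Proof. by apply/asboolP; split => //; exists 1 => x; rewrite mul1r. Qed.

Lemma bopM_subproof S T : `[< is_bounded_linear (S \o T) >].
Proof.
apply/asboolP; split; first by move=> a x y /=; rewrite !linearP.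
have [M M0 SM] := bop_ge0_bound S; have [N N0 TN] := bop_ge0_bound T.
exists (M * N)%:C => x; rewrite !rnormE -rmorphM /= lecR -mulrA.
by apply: (le_trans (SM _)); rewrite ler_wpM2l.
Qed.

Definition bop1 : bop H := Bop bop1_subproof.
Definition bopM S T : bop H := Bop (bopM_subproof S T).

Lemma bopMA : associative bopM. Proof. by move=> S T U; exact: bop_eqP. Qed.
Lemma bop1M : left_id bop1 bopM. Proof. by move=> S; exact: bop_eqP. Qed.
Lemma bopM1 : right_id bop1 bopM. Proof. by move=> S; exact: bop_eqP. Qed.
Lemma bopMDl : left_distributive bopM +%R.
Proof. by move=> S T U; exact: bop_eqP. Qed.
Lemma bopMDr : right_distributive bopM +%R.
Proof. by move=> S T U; apply: bop_eqP => x; exact: raddfD. Qed.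

HB.instance Definition _ := GRing.Zmodule_isPzRing.Build (bop H)
  bopMA bop1M bopM1 bopMDl bopMDr.

Lemma bopME S T x : (S * T) x = S (T x).
Proof. by []. Qed.

End BoundedOperators.

Definition is_adjoint (R : realType) (H : hilbertType R) (T S : bop H) :=
  forall x y, inner (T x) y = inner x (S y).

(* [0] is a dummy value: every bounded operator has a unique adjoint. *)
Definition adjoint (R : realType) (H : hilbertType R) (T : bop H) : bop H :=
  xget 0 [set S | is_adjoint T S].

Definition unitary (R : realType) (H : hilbertType R) (U : bop H) :=
  U * adjoint U = 1 /\ adjoint U * U = 1.

Section SequenceOperators.
Variables (R : realType) (H : hilbertType R).

Definition is_seq_bounded (t : (nat -> H) -> nat -> H) :=
  linear t /\ exists2 M : R, 0 <= M & forall f N,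
    \sum_(n < N) rnorm (t f n) ^+ 2 <= M ^+ 2 * \sum_(n < N) rnorm (f n) ^+ 2.

Section Lift.
Variables (t : (nat -> H) -> nat -> H) (tb : is_seq_bounded t).

Lemma seq_op_le (M : R) (x : ell2 H) : 0 <= M ->
  (forall f N,
    \sum_(n < N) rnorm (t f n) ^+ 2 <=
      M ^+ 2 * \sum_(n < N) rnorm (f n) ^+ 2) ->
  forall N, \sum_(n < N) rnorm (t x n) ^+ 2 <= (M * rnorm x) ^+ 2.
Proof.
move=> M0 tM N; apply: (le_trans (tM _ _)).
by rewrite exprMn ler_wpM2l ?sqr_ge0// ell2_partial.
Qed.

Lemma seq_op_summable (x : ell2 H) : `[< sq_summable (t x) >].
Proof.
have [_ [M M0 tM]] := tb.
by apply/asboolP; apply: sq_summable_bounded (seq_op_le x M0 tM).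
Qed.

Lemma seq_op_bounded :
  `[< is_bounded_linear (fun x => Ell2 (seq_op_summable x)) >].
Proof.
have [tl [M M0 tM]] := tb; apply/asboolP; split.
  by move=> a x y; apply: ell2_eqP => n; exact: (congr1 (@^~ n) (tl a x y)).
exists M%:C => x; rewrite !rnormE -rmorphM /= lecR.
apply: ell2_rnorm_le; first by rewrite mulr_ge0// rnorm_ge0.
exact: seq_op_le.
Qed.

Definition seq_op : bop (ell2 H) := Bop seq_op_bounded.

End Lift.

Lemma amplification_bounded (b : bop H) :
  is_seq_bounded (fun f n => b (f n)).
Proof.
split; first by move=> a f g; apply/funext => n; exact: linearP.
have [M M0 bM] := bop_ge0_bound b; exists M => // f N.
rewrite mulr_sumr ler_sum// => n _; rewrite -exprMn.
by rewrite ler_sqr ?nnegrE ?mulr_ge0 ?rnorm_ge0.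
Qed.

Lemma shift_bounded (b : bop H) :
  is_seq_bounded (fun f n => if n is k.+1 then b (f k) else 0).
Proof.
split.
  move=> a f g; apply/funext => -[|n]; last exact: linearP.
  by rewrite -[RHS]/(a *: 0 + 0) scaler0 addr0.
have [M M0 bM] := bop_ge0_bound b; exists M => // f [|N].
  by rewrite !big_ord0 mulr0.
rewrite big_ord_recl /= rnorm0 expr0n add0r big_ord_recr /= mulrDr.
apply: ler_wpDr; first by rewrite mulr_ge0// sqr_ge0.
rewrite mulr_sumr ler_sum// => n _; rewrite -exprMn.
by rewrite ler_sqr ?nnegrE ?mulr_ge0 ?rnorm_ge0.
Qed.

Definition cis (s : R) : R[i] := cos s +i* sin s.

Lemma normr_cis s : `|cis s| = 1.
Proof. by rewrite normc_def /= cos2Dsin2 sqrtr1. Qed.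

Lemma phase_bounded (s : R) :
  is_seq_bounded (fun f n => cis (n%:R * s) *: f n).
Proof.
split.
  move=> a f g; apply/funext => n.
  by rewrite -[LHS]/(_ *: (a *: f n + g n)) scalerDr !scalerA mulrC -scalerA.
exists 1 => // f N; rewrite expr1n mul1r ler_sum// => n _.
by rewrite rnormZ normr_cis /= mul1r.
Qed.

Lemma tens_summable (x : H) (n : nat) :
  `[< sq_summable (fun k => if k == n then x else 0) >].
Proof.
apply/asboolP/(@sq_summable_bounded _ _ _ (rnorm x ^+ 2)) => N.
have [nN|Nn] := ltnP n N; last first.
  rewrite big1 ?sqr_ge0// => i _; rewrite ltn_eqF ?rnorm0 ?expr0n//.
  exact: leq_trans (ltn_ord i) Nn.
rewrite (bigD1 (Ordinal nN))//= eqxx big1 ?addr0// => i.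
by rewrite -val_eqE /= => /negPf->; rewrite rnorm0 expr0n.
Qed.

(* [tens x n] is the elementary tensor of [x] and the [n]-th basis vector. *)
Definition tens (x : H) (n : nat) : ell2 H := Ell2 (tens_summable x n).

(* [rho b] is the tensor product of [b] and the identity, [shift_tens b] that *)
(* of [b] and the unilateral shift.                                          *)
Definition rho (b : bop H) : bop (ell2 H) := seq_op (amplification_bounded b).

Definition shift_tens (b : bop H) : bop (ell2 H) := seq_op (shift_bounded b).

Definition phase (s : R) : bop (ell2 H) := seq_op (phase_bounded s).

Lemma rho_tens b x n : rho b (tens x n) = tens (b x) n.
Proof. by apply: ell2_eqP => k /=; case: eqP => // _; rewrite linear0. Qed.

Lemma shift_tens_tens b x n : shift_tens b (tens x n) = tens (b x) n.+1.
Proof.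
apply: ell2_eqP => -[|k] //=; rewrite eqSS.
by case: eqP => // _; rewrite linear0.
Qed.

Lemma phase_tens s x n : phase s (tens x n) = cis (n%:R * s) *: tens x n.
Proof.
apply: ell2_eqP => k; rewrite ell2Z /=.
by case: eqP => [->//|_]; rewrite !scaler0.
Qed.

End SequenceOperators.

Section WStar.
Variables (R : realType) (H : hilbertType R).

(* [<(T (X) 1) x, y>] is the sum over [n] of [<T x_n, y_n>]; these are the    *)
(* functionals given by trace class operators, the predual of [bop H].       *)
Definition wstar_functional (T : bop H) :
    prod_topology (fun _ : ell2 H * ell2 H => R[i]^o) :=
  fun p => inner (rho T p.1) p.2.

Definition wstar := initial_topology wstar_functional.

Definition wstar_closed (S : set (bop H)) := closed (S : set wstar).

Definition wstar_closure (S : set (bop H)) : set (bop H) :=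
  closure (S : set wstar).
End WStar.

Section Reflexivity.
Variables (R : realType) (H : hilbertType R).
Implicit Types S A : set (bop H).

Definition is_subspace S :=
  S 0 /\ forall (a : R[i]) T T', S T -> S T' -> S (a *: T + T').

Definition is_unital_subalgebra A :=
  [/\ is_subspace A, A 1 & forall T T', A T -> A T' -> A (T * T')].

Definition Ref S :=
  [set T : bop H | forall x : H, closure [set B x | B in S] (T x)].

Definition is_reflexive S := S = Ref S.

Definition is_hereditarily_reflexive S :=
  forall S', is_subspace S' -> wstar_closed S' -> S' `<=` S -> is_reflexive S'.

End Reflexivity.

Section Semicrossed.
Variables (R : realType) (H0 : hilbertType R).

Definition analytic_polynomials (w : bop H0) (A : set (bop H0)) :
    set (bop (ell2 H0)) :=
  [set T | exists (k : nat) (b : nat -> bop H0), (forall n, A (b n)) /\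
    T = \sum_(n < k.+1) shift_tens (adjoint w) ^+ n * rho (b n)].

Definition semicrossed_product (w : bop H0) (A : set (bop H0)) :=
  wstar_closure (analytic_polynomials w A).

End Semicrossed.

Section Fourier.
Variables (R : realType) (H0 : hilbertType R).

Record tagged_partition := TaggedPartition {
  tp_size : nat ;
  tp_point : nat -> R ;
  tp_tag : nat -> R
}.

Definition is_tagged_partition (a b : R) (P : tagged_partition) :=
  [/\ tp_point P 0 = a, tp_point P (tp_size P) = b &
      forall i, (i < tp_size P)%N ->
        tp_point P i <= tp_tag P i <= tp_point P i.+1].

Definition mesh_lt (d : R) (P : tagged_partition) :=
  forall i, (i < tp_size P)%N -> tp_point P i.+1 - tp_point P i < d.

(* Convergence along this filter is convergence as the mesh tends to 0. *)
Definition fine_partitions (a b : R) : set_system tagged_partition :=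
  filter_from [set d : R | 0 < d]
    (fun d => [set P | is_tagged_partition a b P /\ mesh_lt d P]).

Definition riemann_sum (V : lmodType R[i]) (f : R -> V)
    (P : tagged_partition) :=
  \sum_(i < tp_size P) (tp_point P i.+1 - tp_point P i)%:C *: f (tp_tag P i).

Definition fourier_integrand (T : bop (ell2 H0)) (m : int) (s : R) :
    bop (ell2 H0) :=
  cis (- (m%:~R * s)) *: (phase H0 s * T * adjoint (phase H0 s)).

Definition fourier_coef (T : bop (ell2 H0)) (m : int) : bop (ell2 H0) :=
  (2 * pi)^-1%:C *:
  (lim ((riemann_sum (fourier_integrand T m) P : wstar (ell2 H0))
     @[P --> fine_partitions 0 (2 * pi)]) : bop (ell2 H0)).

Definition G_invariant (S : set (bop (ell2 H0))) :=
  forall (m : int) T, S T -> S (fourier_coef T m).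

End Fourier.

(* Main.v *)
(* Proof idea.  Index operators on ell2 H0 by their matrix entries.  The      *)
(* semicrossed product consists of the lower triangular Toeplitz operators    *)
(* whose m-th diagonal is (adjoint w)^m b_m with b_m in A: these conditions   *)
(* are w*-closed, and conversely such an operator is the w*-limit of its      *)
(* Cesaro means, which are bounded since averaging the compressions to all    *)
(* windows of length N yields the Fejer weights.  The Toeplitz condition      *)
(* passes to Ref because xi (x) (e_j - l^j e_0) is orthogonal to every        *)
(* H0 (x) k_l, k_l = sum_n l^n e_n, and Toeplitz operators preserve this      *)
(* orthogonality.  Evaluating at xi (x) e_0 and reading off coordinate m then *)
(* puts b_m xi in the closure of the values at xi of the m-th coefficients,   *)
(* so b_m lies in Ref of the set of these coefficients and the reflexivity of *)
(* A, respectively of its subspace {b | W^m rho(b) in S}, applies.            *)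

Require Import Defs.
From mathcomp Require Import all_boot all_order all_algebra sesquilinear.
From mathcomp Require Import complex.
From mathcomp Require Import all_classical all_reals topology normedtype.
From mathcomp Require Import sequences derive realfun trigo.
From mathcomp Require Import ring lra zify.
Set Implicit Arguments.
Unset Strict Implicit.
Unset Printing Implicit Defensive.

Import Order.TTheory GRing.Theory Num.Theory numFieldNormedType.Exports.

Local Open Scope classical_set_scope.
Local Open Scope ring_scope.
Local Open Scope complex_scope.

(** * Density of the elementary tensors *)

(** The lemmas that carry the argument are these. [semicrossed_productE] describes the product by
    [toeplitz T] and by the coefficients [coef w T m] lying in [A]. One inclusion holds because
    polynomials satisfy both conditions and both are w*-closed ([closure_toeplitz],
    [wstar_closed_coef]). The other holds because [cesaro w T k] is then a polynomial and converges
    w* to [T] ([cesaro_cvg]). On bounded nets w*-convergence is a matter of matrix entries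
    ([wstar_bounded_cvg]), and [cesaro_form] provides the bound.

    [Ref_toeplitz] and [Ref_coef] carry the two conditions over to the reflexive cover, which proves
    the first claim. For a G-invariant [S], the set of [b] in [A] with [monomial w m b] in [S] is
    w*-closed ([wstar_closed_monomial]). It contains the m-th coefficients of all members of [S],
    since [fourier_coef_toeplitz] identifies G_m(B) with the m-th monomial of [B]. Hereditary
    reflexivity then puts each monomial of an operator in [Ref S] into [S], and the Cesaro means
    reassemble the operator. *)

Section Inner.
Variables (R : realType) (H : hilbertType R).
Implicit Types x y z : H.

Lemma innerC x y : inner y x = Num.conj (inner x y).
Proof. exact: dot_conj. Qed.

Lemma inner0l y : inner (0 : H) y = 0. Proof. exact: linear0l. Qed.
Lemma inner0r x : inner x (0 : H) = 0. Proof. exact: linear0r. Qed.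
Lemma innerDl x x' y : inner (x + x') y = inner x y + inner x' y.
Proof. exact: linearDl. Qed.
Lemma innerDr x y y' : inner x (y + y') = inner x y + inner x y'.
Proof. exact: linearDr. Qed.
Lemma innerBl x x' y : inner (x - x') y = inner x y - inner x' y.
Proof. exact: linearBl. Qed.
Lemma innerZl (a : R[i]) x y : inner (a *: x) y = a * inner x y.
Proof. exact: linearZl_LR. Qed.
Lemma innerZr (a : R[i]) x y : inner x (a *: y) = Num.conj a * inner x y.
Proof. exact: linearZr_LR. Qed.

Lemma inner_bound x y : `|inner x y| <= (rnorm x * rnorm y)%:C.
Proof. by rewrite rmorphM /= -!rnormE; exact: inner_CauchySchwarz. Qed.

Lemma inner_ext x x' : (forall y, inner x y = inner x' y) -> x = x'.
Proof.
move=> xx'; apply/eqP; rewrite -subr_eq0; apply/eqP/rnorm_eq0/eqP.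
rewrite -sqrf_eq0; apply/eqP/complexI; rewrite rmorphXn /= -rnormE.
by rewrite normr_inner innerBl xx' subrr.
Qed.

End Inner.

Section Ell2Density.
Variable R : realType.

(** The inner product of [ell2 H] is built from two real series, for real and imaginary parts. A
    single complex series is what the entrywise computations use. *)
Lemma ell2_cvg (H : hilbertType R) (x y : ell2 H) :
  (fun N => \sum_(n < N) inner (x n) (y n)) @ \oo --> (inner x y : R[i]^o).
Proof.
have [cr ci] := ell2_inner_cvg x y.
apply/cvgrPdist_lt => e /gt0_complex[d d0 ->].
have d20 : 0 < d / 2 by rewrite divr_gt0.
have /cvgrPdist_lt/(_ _ d20) Nr := cr.
have /cvgrPdist_lt/(_ _ d20) Ni := ci.
near=> N.
have : `|limn (series (fun n => complex.Re (inner (x n) (y n)))) -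
  series (fun n => complex.Re (inner (x n) (y n))) N| < d / 2 by near: N.
have : `|limn (series (fun n => complex.Im (inner (x n) (y n)))) -
  series (fun n => complex.Im (inner (x n) (y n))) N| < d / 2 by near: N.
have -> : \sum_(n < N) inner (x n) (y n) =
  series (fun n => complex.Re (inner (x n) (y n))) N +i*
  series (fun n => complex.Im (inner (x n) (y n))) N.
  apply/eqP; rewrite eq_complex !seriesEnat /= !big_mkord !raddf_sum /=.
  by rewrite !eqxx.
have -> : inner x y = ell2_inner x y by [].
rewrite /ell2_inner.
set a := limn _; set b := limn _; set a' := series _ _; set b' := series _ _.
move=> hb ha.
have -> : (b +i* a) - (b' +i* a') = (b - b')%:C + (0 +i* (a - a')) :> R[i].
  by apply/eqP; rewrite eq_complex /=; apply/andP; split; apply/eqP; ring.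
apply: le_lt_trans (ler_normD _ _) _.
rewrite !normc_def /= expr0n /= addr0 add0r !sqrtr_sqr.
rewrite -rmorphD ltcR; lra.
Unshelve. all: by end_near. Qed.


Lemma inner_tensr (H : hilbertType R) (x : ell2 H) y n :
  inner x (tens y n) = inner (x n) y.
Proof.
apply: (cvg_unique (@norm_hausdorff _ R[i]^o) (@ell2_cvg _ x (tens y n))).
apply: cvg_near_cst; exists n.+1 => // N /= nN.
rewrite (bigD1 (Ordinal nN))//= eqxx big1 ?addr0// => i.
by rewrite -val_eqE /= => /negPf->; rewrite inner0r.
Qed.

Lemma inner_tensl (H : hilbertType R) (x : ell2 H) y n :
  inner (tens y n) x = inner y (x n).
Proof. by rewrite innerC inner_tensr -innerC. Qed.

Lemma inner_tens (H : hilbertType R) (x y : H) n m :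
  inner (tens x n) (tens y m) = if n == m then inner x y else 0.
Proof. by rewrite inner_tensr /= eq_sym; case: eqP => // _; rewrite inner0l. Qed.

Lemma rnorm_ell2_le (H : hilbertType R) (x : ell2 H) (B : R) : 0 <= B ->
  (forall N, \sum_(n < N) rnorm (x n) ^+ 2 <= B) -> rnorm x ^+ 2 <= B.
Proof.
move=> B0 xB; rewrite -(sqr_sqrtr B0) ler_sqr ?nnegrE ?rnorm_ge0 ?sqrtr_ge0//.
by apply: ell2_rnorm_le => [|N]; rewrite ?sqrtr_ge0// sqr_sqrtr.
Qed.

Definition trunc (H : hilbertType R) (x : ell2 H) N :=
  \sum_(n < N) tens (x n) n.

Lemma truncE (H : hilbertType R) (x : ell2 H) N k :
  trunc x N k = if (k < N)%N then x k else 0.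
Proof.
elim: N => [|N IH]; first by rewrite /trunc big_ord0.
rewrite /trunc big_ord_recr ell2D [X in X + _]IH /= [in RHS]ltnS [in RHS]leq_eqVlt.
by case: (ltngtP k N) => [kN|kN|->]; rewrite /= ?addr0 ?add0r.
Qed.

Lemma trunc_near (H : hilbertType R) (x : ell2 H) (e : R) : 0 < e ->
  exists N, rnorm (x - trunc x N) < e.
Proof.
(* The tail estimate is not strict, so it is made at e^2 / 4 to end strictly below e^2. *)
move=> e0; have e20 : 0 < e ^+ 2 / 4 by rewrite divr_gt0// exprn_gt0.
have /cvgrPdist_lt/(_ _ e20)[N _ /(_ N (leqnn N))] := @ell2P _ _ x.
rewrite /= ltr_norml => /andP[_]; set l := limn _ => hN; exists N.
rewrite -ltr_sqr ?nnegrE ?rnorm_ge0 ?ltW//.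
apply: (@le_lt_trans _ _ (e ^+ 2 / 4)); last by rewrite expr2; nra.
apply: rnorm_ell2_le => [|M]; first exact: ltW.
apply: le_trans (ltW hN).
have sq0 n : 0 <= rnorm (x n) ^+ 2 by rewrite sqr_ge0.
have -> : \sum_(n < M) rnorm ((x - trunc x N) n) ^+ 2 =
    \sum_(0 <= n < M) if (n < N)%N then 0 else rnorm (x n) ^+ 2.
  rewrite big_mkord; apply: eq_bigr => n _; rewrite ell2D ell2N truncE.
  by case: ifP; rewrite ?subrr ?subr0// rnorm0 expr0n.
have [MN|/ltnW NM] := leqP M N.
  rewrite big_nat big1 => [|i /andP[_ iM]]; last by rewrite (leq_trans iM MN).
  by rewrite subr_ge0; exact: (series_nneg_le sq0 (@ell2P _ _ x) N).
have := series_nneg_le sq0 (@ell2P _ _ x) M; rewrite -/l !seriesEnat /=.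
rewrite lerBrDr; apply: le_trans.
rewrite [leRHS](@big_cat_nat _ _ _ N)//= [leLHS]addrC lerD2l (@big_cat_nat _ _ _ N)//=.
rewrite big_nat big1 => [|i /andP[_ ->]//]; rewrite add0r.
rewrite big_nat [leRHS]big_nat ler_sum// => i /andP[Ni _].
by rewrite ltnNge Ni.
Qed.

Lemma cvgC0P I (F : set_system I) {FF : Filter F} (f : I -> R[i]) :
  f @ F --> (0 : R[i]^o) <->
  forall d : R, 0 < d -> \forall i \near F, `|f i| < d%:C.
Proof.
split=> [/(@cvgr0_norm_lt _ R[i]^o) f0 d d0|f0]; first by apply: f0; rewrite ltcR.
by apply/(@cvgr0Pnorm_lt _ R[i]^o) => e /gt0_complex[d d0 ->]; exact: f0.
Qed.

(** Truncate [x]: the remainder is uniformly small by the bound, and the truncation is a finite sum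
    of tensors. Additivity suffices, so the lemma serves the linear and the conjugate-linear slot of
    a form alike. *)
Lemma cvg0_tens (H : hilbertType R) I (F : set_system I) {FF : Filter F}
    (phi : I -> ell2 H -> R[i]) (C : R) :
  (forall i x y, phi i (x + y) = phi i x + phi i y) ->
  (\forall i \near F, forall x, `|phi i x| <= (C * rnorm x)%:C) ->
  (forall x n, phi^~ (tens x n) @ F --> (0 : R[i]^o)) ->
  forall x, phi^~ x @ F --> (0 : R[i]^o).
Proof.
move=> phiD phiC phi0 x; apply/cvgC0P => d d0.
have [C' C0 CC'] : exists2 C' : R, 0 < C' & C <= C'.
  by exists (`|C| + 1); rewrite ?ltr_wpDl// (le_trans (ler_norm C))// lerDl.
have [N xN] := trunc_near x (divr_gt0 d0 (mulr_gt0 (ltr0n R 2) C0)).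
have cN : phi^~ (trunc x N) @ F --> (0 : R[i]^o).
  rewrite /trunc; elim: N {xN} => [|N IH].
    rewrite big_ord0 (_ : phi^~ 0 = fun=> 0); first exact: (@cvg_cst R[i]^o).
    by apply/funext => i; apply: (addrI (phi i 0)); rewrite -phiD !addr0.
  rewrite big_ord_recr /= -[X in _ --> X]addr0.
  under eq_fun do rewrite phiD; exact: (@cvgD R[i] R[i]^o).
have /cvgC0P/(_ _ (divr_gt0 d0 (ltr0n R 2))) := cN.
apply: filterS2 phiC => i hC hN.
rewrite -(subrK (trunc x N) x) phiD; apply: le_lt_trans (ler_normD _ _) _.
rewrite [d](splitr d) rmorphD; apply: ler_ltD hN.
apply: le_trans (hC _) _; rewrite lecR.
apply: (@le_trans _ _ (C' * (d / (2 * C')))); last first.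
  by rewrite (_ : _ * _ = d / 2)//; field; rewrite gt_eqF.
apply: (@le_trans _ _ (C' * rnorm (x - trunc x N))).
  by rewrite ler_wpM2r// rnorm_ge0.
by rewrite ler_wpM2l// ltW.
Qed.

Lemma cvg0_biadd_tens (H K : hilbertType R) I (F : set_system I) {FF : Filter F}
    (B : I -> ell2 H -> ell2 K -> R[i]) (C : R) :
  (forall i x x' y, B i (x + x') y = B i x y + B i x' y) ->
  (forall i x y y', B i x (y + y') = B i x y + B i x y') ->
  (\forall i \near F, forall x y, `|B i x y| <= (C * rnorm x * rnorm y)%:C) ->
  (forall x n y m, (fun i => B i (tens x n) (tens y m)) @ F --> (0 : R[i]^o)) ->
  forall x y, (fun i => B i x y) @ F --> (0 : R[i]^o).
Proof.
move=> BDl BDr BC B0 x y.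
apply: (@cvg0_tens _ _ _ _ (fun i y => B i x y) (C * rnorm x)) => //.
  by apply: filterS BC => i BC' z; exact: BC'.
move=> {}y m.
apply: (@cvg0_tens _ _ _ _ (fun i x => B i x (tens y m)) (C * rnorm (tens y m))) => //.
by apply: filterS BC => i BC' z; rewrite mulrAC; exact: BC'.
Qed.

(** The difference of the two forms, taken as a constant net, tends both to its own value and to
    0. *)
Lemma biadd_tens_eq (H K : hilbertType R) (B B' : ell2 H -> ell2 K -> R[i])
    (C C' : R) :
  (forall x x' y, B (x + x') y = B x y + B x' y) ->
  (forall x y y', B x (y + y') = B x y + B x y') ->
  (forall x y, `|B x y| <= (C * rnorm x * rnorm y)%:C) ->
  (forall x x' y, B' (x + x') y = B' x y + B' x' y) ->
  (forall x y y', B' x (y + y') = B' x y + B' x y') ->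
  (forall x y, `|B' x y| <= (C' * rnorm x * rnorm y)%:C) ->
  (forall x n y m, B (tens x n) (tens y m) = B' (tens x n) (tens y m)) ->
  forall x y, B x y = B' x y.
Proof.
move=> BDl BDr BC BDl' BDr' BC' BB' x y; apply/subr0_eq.
apply: (cvg_unique (@norm_hausdorff _ R[i]^o) (F := (fun=> B x y - B' x y) @ \oo)).
  exact: (@cvg_cst R[i]^o).
apply: (@cvg0_biadd_tens _ _ nat \oo _ (fun _ x y => B x y - B' x y) (C + C')).
- by move=> _ a b c; rewrite BDl BDl' opprD addrACA.
- by move=> _ a b c; rewrite BDr BDr' opprD addrACA.
- apply: nearW => _ a b; rewrite !mulrDl rmorphD; apply: le_trans (ler_normB _ _) _.
  exact: lerD.
- by move=> a n b m; rewrite BB' subrr; exact: (@cvg_cst R[i]^o).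
Qed.

End Ell2Density.

(** * The w*-topology *)

Section WStar.
Variable R : realType.

Lemma wstar_cvg (H : hilbertType R) I (F : set_system I) {FF : Filter F}
    (f : I -> wstar H) (T : wstar H) :
  (forall x y, (fun i => inner (rho (f i) x) y) @ F --> (inner (rho T x) y : R[i]^o)) ->
  f @ F --> T.
Proof.
move=> fT U [_ [[V oV <-]] /= VT /filterS]; apply.
suff : (@wstar_functional R H \o f) @ F --> @wstar_functional R H T.
  by apply; exact: open_nbhs_nbhs.
apply/cvg_sup => p A [_ [[B oB <-]] /= Bp /filterS]; apply.
by apply: (fT p.1 p.2); exact: open_nbhs_nbhs.
Qed.

Lemma wstar_functional_continuous (H : hilbertType R) (x y : ell2 H) :
  continuous ((fun T => inner (rho T x) y) : wstar H -> R[i]^o).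
Proof.
move=> T; apply: (@continuous_comp (wstar H) _ _ (@wstar_functional R H)
  (@proj _ (fun=> R[i]^o) (x, y))).
  exact: initial_continuous.
exact: proj_continuous.
Qed.

Lemma wstar_inner_continuous (H : hilbertType R) (u v : H) :
  continuous ((fun T : bop H => inner (T u) v) : wstar H -> R[i]^o).
Proof.
rewrite (_ : (fun _ => _) = fun T : bop H => inner (rho T (tens u 0)) (tens v 0)).
  exact: wstar_functional_continuous.
by apply/funext => T; rewrite rho_tens inner_tens.
Qed.

Lemma wstar_hausdorff (H : hilbertType R) : hausdorff_space (wstar H).
Proof.
move=> S T ST; apply: bop_eqP => u; apply: inner_ext => v.
apply: (@norm_hausdorff _ R[i]^o) => A B AS BT.
have [U [US UT]] := ST _ _ (wstar_inner_continuous AS) (wstar_inner_continuous BT).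
by exists (inner ((U : bop H) u) v).
Qed.

(** The hypothesis says that the pullback of each defining functional is again one. Continuity of
    the coefficient and monomial maps thus reduces to finding [x'] and [y']. *)
Lemma wstar_continuous (H K : hilbertType R) (g : bop H -> bop K) :
  (forall x y, exists x' y', forall T, inner (rho (g T) x) y = inner (rho T x') y') ->
  continuous (g : wstar H -> wstar K).
Proof.
move=> gE T.
apply: (@wstar_cvg K _ (nbhs (T : wstar H)) (@nbhs_filter (wstar H) T) g) => x y.
have [x' [y' E]] := gE x y.
have /funext -> : (fun i => inner (rho (g i) x) y) =1
  (fun i => inner (rho i x') y') by exact: E.
rewrite E.
exact: wstar_functional_continuous.
Qed.

Lemma wstar_closed_preimage (H K : hilbertType R) (g : bop H -> bop K) S :
  (forall x y, exists x' y', forall T, inner (rho (g T) x) y = inner (rho T x') y') ->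
  wstar_closed S -> wstar_closed (g @^-1` S).
Proof. by move=> gE; apply: preimage_closed => T _; exact: wstar_continuous. Qed.

Lemma wstar_closure_min (H : hilbertType R) (S M : set (bop H)) :
  S `<=` M -> wstar_closed M -> wstar_closure S `<=` M.
Proof.
move=> SM /closure_id MM T; rewrite [M]MM; exact: (@closureS (wstar H)).
Qed.

Lemma wstar_closed_eq (H : hilbertType R) (u v u' v' : H) :
  wstar_closed [set T : bop H | inner (T u) v = inner (T u') v'].
Proof.
have -> : [set T : bop H | inner (T u) v = inner (T u') v'] =
    ((fun T : bop H => inner (T u) v - inner (T u') v') : wstar H -> R[i]^o) @^-1` [set 0].
  by apply/seteqP; split => T /= => [->|/subr0_eq//]; rewrite subrr.
apply: preimage_closed; last first.
  exact/accessible_closed_set1/hausdorff_accessible/(@norm_hausdorff _ R[i]^o).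
move=> T _; apply: (@cvgB R[i] R[i]^o _ (nbhs (T : wstar H)) (@nbhs_filter (wstar H) T));
  exact: (@wstar_inner_continuous H _ _ T).
Qed.

Lemma rho0 (H : hilbertType R) (x : ell2 H) : rho 0 x = 0.
Proof. exact: ell2_eqP. Qed.

(** Testing the form at v = T u bounds [T], and [rho T] acts coordinatewise with the same
    constant. *)
Lemma rho_bound (H : hilbertType R) (T : bop H) (C : R) : 0 <= C ->
  (forall u v, `|inner (T u) v| <= (C * rnorm u * rnorm v)%:C) ->
  forall x, rnorm (rho T x) <= C * rnorm x.
Proof.
move=> C0 TC x.
have TuC u : rnorm (T u) <= C * rnorm u.
  have [->|Tu0] := eqVneq (T u) 0; first by rewrite rnorm0 mulr_ge0 ?rnorm_ge0.
  have Tup : 0 < rnorm (T u).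
    rewrite lt_neqAle rnorm_ge0 andbT eq_sym; apply: contra_neq Tu0; exact: rnorm_eq0.
  rewrite -(ler_pM2r Tup); have := TC u (T u).
  rewrite -normr_inner ger0_norm ?exprn_ge0// rnormE -rmorphXn /= lecR expr2.
  by [].
apply: ell2_rnorm_le => [|N]; first by rewrite mulr_ge0 ?rnorm_ge0.
rewrite exprMn; apply: le_trans (ler_wpM2l (sqr_ge0 C) (ell2_partial x N)).
rewrite mulr_sumr ler_sum// => n _; rewrite -exprMn.
by rewrite ler_sqr ?nnegrE ?mulr_ge0 ?rnorm_ge0 //; exact: TuC.
Qed.

Lemma bop_form_bound (H : hilbertType R) (T : bop H) :
  exists2 C : R, 0 <= C & forall u v, `|inner (T u) v| <= (C * rnorm u * rnorm v)%:C.
Proof.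
have [C C0 TC] := bop_ge0_bound T; exists C => // u v.
apply: le_trans (inner_bound _ _) _; rewrite lecR.
by apply: ler_wpM2r; [exact: rnorm_ge0|exact: TC].
Qed.

Lemma wot_bounded_cvg (H : hilbertType R) I (F : set_system I) {FF : Filter F}
    (f : I -> bop (ell2 H)) (T : bop (ell2 H)) (C : R) :
  (\forall i \near F, forall u v, `|inner (f i u) v| <= (C * rnorm u * rnorm v)%:C) ->
  (forall x n y m, (fun i => inner (f i (tens x n)) (tens y m)) @ F -->
    (inner (T (tens x n)) (tens y m) : R[i]^o)) ->
  forall x y, (fun i => inner (f i x) y) @ F --> (inner (T x) y : R[i]^o).
Proof.
move=> fC fT x y; have [D _ TD] := bop_form_bound T.
have cvgB0 (a : I -> R[i]) (b : R[i]) :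
    (a @ F --> (b : R[i]^o)) <-> ((fun i => a i - b) @ F --> (0 : R[i]^o)).
  apply: iff_sym; exact: (@subr_cvg0 R[i] R[i]^o).
apply/(iffRL (cvgB0 _ _)).
apply: (@cvg0_biadd_tens _ _ _ _ _ _ (fun i x y => inner (f i x) y - inner (T x) y) (C + D)).
- by move=> i a b c; rewrite !raddfD !innerDl opprD addrACA.
- by move=> i a b c; rewrite !innerDr opprD addrACA.
- apply: filterS fC => i fiC u v; rewrite !mulrDl rmorphD.
  by apply: le_trans (ler_normB _ _) _; exact: (lerD (fiC u v) (TD u v)).
- by move=> u n v m; exact: (iffLR (cvgB0 _ _) (fT u n v m)).
Qed.

(** [wot_bounded_cvg] is used twice: for the amplifications [rho (f i)], whose entries are values of
    the form of [f i], and then for [f] itself. *)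
Lemma wstar_bounded_cvg (H : hilbertType R) I (F : set_system I) {FF : Filter F}
    (f : I -> bop (ell2 H)) (T : bop (ell2 H)) (C : R) : 0 <= C ->
  (\forall i \near F, forall u v, `|inner (f i u) v| <= (C * rnorm u * rnorm v)%:C) ->
  (forall x n y m, (fun i => inner (f i (tens x n)) (tens y m)) @ F -->
    (inner (T (tens x n)) (tens y m) : R[i]^o)) ->
  f @ F --> (T : wstar (ell2 H)).
Proof.
move=> C0 fC fT; apply: wstar_cvg; apply: (@wot_bounded_cvg _ _ _ _ _ _ C).
  apply: filterS fC => i fiC x y; apply: le_trans (inner_bound _ _) _.
  by rewrite lecR; apply: ler_wpM2r; [exact: rnorm_ge0|exact: rho_bound].
move=> u n v m; rewrite rho_tens inner_tens.
under eq_fun do rewrite rho_tens inner_tens.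
case: (n == m); last exact: (@cvg_cst R[i]^o).
exact: (wot_bounded_cvg fC).
Qed.
End WStar.

(** * Toeplitz operators and their Cesaro means *)

Section Operators.
Variables (R : realType) (H : hilbertType R).
Implicit Types (S T w : bop H).

Lemma bopDE S T x : (S + T) x = S x + T x. Proof. by []. Qed.
Lemma bopZE (a : R[i]) T x : (a *: T) x = a *: T x. Proof. by []. Qed.
Lemma bop1E x : (1 : bop H) x = x. Proof. by []. Qed.

Lemma bop_sumE I (r : seq I) (P : pred I) (T : I -> bop H) x :
  (\sum_(i <- r | P i) T i) x = \sum_(i <- r | P i) T i x.
Proof. by elim/big_rec2: _ => // i y1 y2 _ <-. Qed.

Lemma inner_suml I (r : seq I) (P : pred I) (f : I -> H) y :
  inner (\sum_(i <- r | P i) f i) y = \sum_(i <- r | P i) inner (f i) y.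
Proof.
by elim/big_rec2: _ => [|i y1 y2 _ <-]; rewrite ?inner0l ?innerDl.
Qed.

Lemma adjoint_eq T S : is_adjoint T S -> adjoint T = S.
Proof.
move=> TS; have TaT : is_adjoint T (adjoint T).
  by apply: (@xgetPex _ 0 [set S | is_adjoint T S]); exists S.
apply: bop_eqP => y; apply: inner_ext => x.
by rewrite innerC [RHS]innerC -TS -TaT.
Qed.

(* If [w] had no adjoint, [adjoint w] would be the dummy value [0], so that   *)
(* [1 = 0], [H] is trivial and [0] is an adjoint after all.                   *)
Lemma unitary_is_adjoint w : unitary w -> is_adjoint w (adjoint w).
Proof.
move=> [_ w1]; have [|noadj] := pselect (exists S, is_adjoint w S).
  exact: (@xgetPex _ 0 [set S | is_adjoint w S]).
have a0 : adjoint w = 0 by apply: xgetPN => S wS; apply: noadj; exists S.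
move: w1; rewrite a0 mul0r => H0 x y.
by rewrite -[y]bop1E -H0 !inner0r.
Qed.

Lemma is_adjointX T S n : is_adjoint T S -> is_adjoint (T ^+ n) (S ^+ n).
Proof.
move=> TS; elim: n => [|n IH] x y //.
by rewrite exprS exprSr !bopME TS IH.
Qed.

Lemma unitaryX w n : unitary w ->
  w ^+ n * adjoint w ^+ n = 1 /\ adjoint w ^+ n * w ^+ n = 1.
Proof.
move=> [ww ww']; elim: n => [|n [IH IH']]; first by rewrite !expr0 mul1r.
by split; rewrite exprSr exprS mulrA -[X in X * _ = _]mulrA ?ww ?ww' mulr1.
Qed.

Lemma tensD x y n : tens (x + y) n = tens x n + tens y n :> ell2 H.
Proof. by apply: ell2_eqP => k; rewrite ell2D /=; case: eqP; rewrite ?addr0. Qed.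

Lemma tensZ (a : R[i]) x n : tens (a *: x) n = a *: tens x n :> ell2 H.
Proof. by apply: ell2_eqP => k; rewrite ell2Z /=; case: eqP; rewrite ?scaler0. Qed.

Lemma rnorm_tens (x : H) n : rnorm (tens x n) = rnorm x.
Proof.
apply/eqP; rewrite -(@eqrXn2 _ 2)// ?rnorm_ge0//; apply/eqP/complexI.
by rewrite !rmorphXn /= -!rnormE !normr_inner inner_tens eqxx.
Qed.

End Operators.

Section Toeplitz.
Variables (R : realType) (H : hilbertType R).
Implicit Types (T : bop (ell2 H)) (w b : bop H).

Lemma entry_bounded T m : `[< is_bounded_linear (fun x : H => T (tens x 0) m) >].
Proof.
apply/asboolP; split.
  by move=> a x y; rewrite tensD tensZ linearP.
have [C C0 TC] := bop_ge0_bound T; exists C%:C => x.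
rewrite !rnormE -rmorphM /= lecR; apply: le_trans (ell2_coord_le _ _) _.
by rewrite -(rnorm_tens x 0); exact: TC.
Qed.

Definition entry T m : bop H := Bop (entry_bounded T m).

(* [T = sum_m adjoint w ^+ m * coef w T m (x) v ^ m] when [toeplitz T]. *)
Definition coef w T m := w ^+ m * entry T m.

(** Lower triangularity is included, so this amounts to commuting with [shift_tens 1]. The truncated
    subtraction is only read where [j <= i]. *)
Definition toeplitz T := forall x j i,
  T (tens x j) i = if (j <= i)%N then T (tens x 0) (i - j)%N else 0.

Definition monomial w m b := shift_tens (adjoint w) ^+ m * rho b.

Lemma monomial_tens w m b x j :
  monomial w m b (tens x j) = tens ((adjoint w ^+ m) (b x)) (j + m).
Proof.
rewrite /monomial bopME rho_tens; elim: m => [|m IH]; first by rewrite !expr0 addn0.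
by rewrite !exprS !bopME IH shift_tens_tens addnS.
Qed.

Lemma shiftXE b m x i :
  (shift_tens b ^+ m) x i = if (m <= i)%N then (b ^+ m) (x (i - m)%N) else 0.
Proof.
elim: m i => [|m IH] i; first by rewrite !expr0 subn0.
rewrite exprS bopME /=; case: i => [|i]//; rewrite IH ltnS subSS.
by case: ifP => _; rewrite ?linear0// exprS bopME.
Qed.

Lemma monomialE w m b x i :
  monomial w m b x i = if (m <= i)%N then (adjoint w ^+ m) (b (x (i - m)%N)) else 0.
Proof. exact: shiftXE. Qed.

Lemma monomial_toeplitz w m b : toeplitz (monomial w m b).
Proof.
move=> x j i; rewrite !monomial_tens /= add0n.
have [ji|ij] := leqP j i; first by rewrite -[in RHS](eqn_add2l j) subnKC.
by rewrite ltn_eqF// ltn_addr.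
Qed.

Lemma coef_monomial w m b n : unitary w ->
  coef w (monomial w m b) n = if n == m then b else 0.
Proof.
move=> wu; apply: bop_eqP => x; rewrite /coef bopME.
rewrite (_ : entry _ _ x = monomial w m b (tens x 0) n)// monomial_tens /= add0n.
have [->|nm] := eqVneq n m; last by rewrite linear0.
by rewrite -[LHS]/((w ^+ m * adjoint w ^+ m) (b x)) (unitaryX m wu).1.
Qed.

Lemma toeplitz_inner T x j y i : toeplitz T ->
  inner (T (tens x j)) (tens y i) =
  if (j <= i)%N then inner (T (tens x 0) (i - j)%N) y else 0.
Proof. by move=> Tt; rewrite inner_tensr Tt; case: ifP => // _; rewrite inner0l. Qed.

Lemma monomial_coefE w T m x n : unitary w ->
  monomial w m (coef w T m) (tens x n) = tens (T (tens x 0) m) (n + m).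
Proof.
move=> wu; rewrite monomial_tens /coef bopME; congr (tens _ _).
by rewrite -[LHS]/((adjoint w ^+ m * w ^+ m) (entry T m x)) (unitaryX m wu).2.
Qed.

Lemma monomialZ w m a b : monomial w m (a *: b) = a *: monomial w m b.
Proof.
apply: bop_eqP => x; apply: ell2_eqP => i.
rewrite bopZE ell2Z !monomialE bopZE; case: ifP => _; last by rewrite scaler0.
exact: linearZ.
Qed.

Lemma monomialD w m b c : monomial w m (b + c) = monomial w m b + monomial w m c.
Proof.
apply: bop_eqP => x; apply: ell2_eqP => i.
rewrite bopDE ell2D !monomialE bopDE; case: ifP => _; last by rewrite addr0.
exact: raddfD.
Qed.

End Toeplitz.

Section Cesaro.
Variables (R : realType) (H : hilbertType R).
Implicit Types (x y : ell2 H).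

(** Keeps the N coordinates of [x] that end at [k]. Windows reaching below 0 are allowed, so that
    every coordinate n is seen by exactly N of them, k = n, ..., n + N - 1. *)
Definition window N x k n : H := if (n <= k < n + N)%N then x n else 0.

Lemma window_le N x k L :
  \sum_(n < L) rnorm (window N x k n) ^+ 2 <=
  \sum_(n < k.+1) if (k < n + N)%N then rnorm (x n) ^+ 2 else 0.
Proof.
have sq0 n : 0 <= if (k < n + N)%N then rnorm (x n) ^+ 2 else 0.
  by case: ifP => // _; rewrite sqr_ge0.
rewrite -(big_mkord xpredT (fun n => rnorm (window N x k n) ^+ 2)).
rewrite -(big_mkord xpredT (fun n => if (k < n + N)%N then rnorm (x n) ^+ 2 else 0)).
have E n : rnorm (window N x k n) ^+ 2 =
    if (n < k.+1)%N then if (k < n + N)%N then rnorm (x n) ^+ 2 else 0 else 0.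
  rewrite /window ltnS; case: (leqP n k) => _ /=; last by rewrite rnorm0 expr0n.
  by case: ifP => // _; rewrite rnorm0 expr0n.
under eq_bigr do rewrite E.
have [Lk|/ltnW kL] := leqP L k.+1.
  rewrite [leRHS](@big_cat_nat _ _ _ L)//=; apply: ler_wpDr; first exact: sumr_ge0.
  rewrite big_nat [leRHS]big_nat ler_sum// => n /andP[_ nL].
  by rewrite (leq_trans nL Lk).
rewrite (@big_cat_nat _ _ _ k.+1)//= [X in _ + X]big_nat [X in _ + X]big1.
  by rewrite addr0 big_nat [leRHS]big_nat ler_sum// => n /andP[_ ->].
by move=> n /andP[kn _]; rewrite ltnNge kn.
Qed.

Lemma window_summable N x k : `[< sq_summable (window N x k) >].
Proof. apply/asboolP; apply: sq_summable_bounded; exact: window_le. Qed.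

Definition windowed N x k : ell2 H := Ell2 (window_summable N x k).

Lemma sum_window (V : nmodType) (c : V) n N L :
  \sum_(i < L) (if (n <= i < n + N)%N then c else 0) = c *+ (minn L (n + N) - n).
Proof.
elim: L => [|L IH]; first by rewrite big_ord0 min0n sub0n.
rewrite big_ord_recr /= IH; case: ifP => Ln; rewrite ?addr0 -?mulrSr; congr (_ *+ _); lia.
Qed.

(** After exchanging the sums, each coordinate is counted once per window that sees it, hence at
    most N times. *)
Lemma windowed_sum_le N x L :
  \sum_(k < L) rnorm (windowed N x k) ^+ 2 <= N%:R * rnorm x ^+ 2.
Proof.
have step (k : nat) : rnorm (windowed N x k) ^+ 2 <=
    \sum_(n < k.+1) if (k < n + N)%N then rnorm (x n) ^+ 2 else 0.
  apply: rnorm_ell2_le => [|M]; last exact: window_le.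
  by apply: sumr_ge0 => n _; case: ifP => // _; rewrite sqr_ge0.
apply: (@le_trans _ _ (\sum_(k < L) \sum_(n < L)
  if (n <= k < n + N)%N then rnorm (x n) ^+ 2 else 0)).
  apply: ler_sum => k _; apply: le_trans (step k) _.
  rewrite (big_ord_widen L (fun n => if (k < n + N)%N then rnorm (x n) ^+ 2 else 0))//.
  by rewrite big_mkcond /= ler_sum// => n _; rewrite ltnS; case: (leqP n k).
rewrite exchange_big /=.
apply: le_trans (ler_wpM2l (ler0n R N) (ell2_partial x L)).
rewrite mulr_sumr ler_sum// => n _; rewrite sum_window mulr_natl.
by apply: ler_wpMn2l; rewrite ?sqr_ge0// leq_subLR geq_minr.
Qed.

Lemma windows_summable N x : `[< sq_summable (windowed N x) >].
Proof. apply/asboolP; apply: sq_summable_bounded; exact: windowed_sum_le. Qed.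

(** Collects all windows P_k x into one vector, so that pairing [rho T (windows N x)] with
    [windows N y] sums the compressions P_k T P_k over k. *)
Definition windows N x : ell2 (ell2 H) := Ell2 (windows_summable N x).

Lemma rnorm_windows N x : rnorm (windows N x) ^+ 2 <= N%:R * rnorm x ^+ 2.
Proof.
apply: rnorm_ell2_le => [|L]; last exact: windowed_sum_le.
by rewrite mulr_ge0 ?sqr_ge0.
Qed.

Lemma windowsD N x y : windows N (x + y) = windows N x + windows N y.
Proof.
apply: ell2_eqP => k; apply: ell2_eqP => n; rewrite !ell2D /= /window.
by case: ifP; rewrite ?addr0.
Qed.


Lemma windows_tens N (x : H) j :
  windows N (tens x j) = \sum_(a < N) tens (tens x j) (j + a).
Proof.
apply: ell2_eqP => k; apply: ell2_eqP => n /=; rewrite /window.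
have valE (I : eqType) (r : seq I) (f : I -> ell2 (ell2 H)) :
    (\sum_(i <- r) f i) k = \sum_(i <- r) f i k by elim/big_rec2: _ => // i y1 y2 _ <-.
have valE' (I : eqType) (r : seq I) (f : I -> ell2 H) :
    (\sum_(i <- r) f i) n = \sum_(i <- r) f i n by elim/big_rec2: _ => // i y1 y2 _ <-.
rewrite valE valE' /=.
have [kj|] := boolP (j <= k < j + N)%N.
  have kN : (k - j < N)%N by lia.
  rewrite (bigD1 (Ordinal kN))//= subnKC ?(andP kj).1// eqxx big1.
    by rewrite addr0 /=; case: eqP => [->|_]; [rewrite kj|case: ifP].
  move=> i ik; rewrite (_ : (k == _) = false)//.
  by apply/negbTE; apply: contra ik => /eqP E; apply/eqP/val_inj => /=; lia.
move=> kj; rewrite big1 => [|i _].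
  by case: ifP => // nk; case: eqP => // nj; rewrite -nj nk in kj.
by rewrite (_ : (k == _) = false)//; have := ltn_ord i; lia.
Qed.

(** For j <= l, the coordinates j and l share the windows with l <= k < j + N, which are N - (l - j)
    in number. *)
Lemma windows_form N (T : bop (ell2 H)) (x y : H) j l : toeplitz T ->
  inner (rho T (windows N (tens x j))) (windows N (tens y l)) =
  inner (T (tens x j)) (tens y l) *+ (N - (l - j)).
Proof.
move=> Tt; rewrite windows_tens linear_sum inner_suml.
have E (a : 'I_N) : inner (rho T (tens (tens x j) (j + a))) (windows N (tens y l)) =
    if (l <= j + a < l + N)%N then inner (T (tens x j)) (tens y l) else 0.
  rewrite rho_tens inner_tensl.
  rewrite (_ : windows _ _ _ = if (l <= j + a < l + N)%N then tens y l else 0).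
    by case: ifP; rewrite ?inner0r.
  apply: ell2_eqP => n; rewrite /= /window; have [->|nl] := eqVneq n l.
    by case: ifP; rewrite //= eqxx.
  by case: ifP; case: ifP => //= _ _; rewrite ifN.
under eq_bigr do rewrite E.
(* Above the diagonal the truncated [l - j] is 0, but the entry itself vanishes. *)
have [jl|lj] := leqP j l; last first.
  have -> : inner (T (tens x j)) (tens y l) = 0 by rewrite toeplitz_inner// ifN// -ltnNge.
  rewrite mul0rn big1 // => a _.
  by case: ifP.
rewrite (_ : (N - (l - j))%N = (minn N (l - j + N) - (l - j))%N); last by lia.
rewrite -sum_window; apply: eq_bigr => a _.
by congr (if _ then _ else _); lia.
Qed.

Lemma windows_form_le N (T : bop (ell2 H)) (C : R) : 0 <= C ->
  (forall u v, `|inner (T u) v| <= (C * rnorm u * rnorm v)%:C) ->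
  forall x y, `|inner (rho T (windows N x)) (windows N y)| <=
    (N%:R * C * rnorm x * rnorm y)%:C.
Proof.
move=> C0 TC x y; apply: le_trans (inner_bound _ _) _; rewrite lecR.
have wN z : rnorm (windows N z) <= Num.sqrt N%:R * rnorm z.
  rewrite -ler_sqr ?nnegrE ?mulr_ge0 ?rnorm_ge0 ?sqrtr_ge0//.
  by rewrite exprMn sqr_sqrtr// rnorm_windows.
apply: (@le_trans _ _ (C * (Num.sqrt N%:R * rnorm x) * (Num.sqrt N%:R * rnorm y))).
  apply: ler_pM; [exact: rnorm_ge0|exact: rnorm_ge0| |exact: wN].
  by apply: le_trans (rho_bound C0 TC _) _; apply: ler_wpM2l => //; exact: wN.
have sN : Num.sqrt N%:R * Num.sqrt N%:R = N%:R :> R by rewrite -expr2 sqr_sqrtr.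
by rewrite -[in leRHS]sN le_eqVlt; apply/orP; left; apply/eqP; ring.
Qed.

Definition cesaro (w : bop H) (T : bop (ell2 H)) k :=
  \sum_(m < k.+1) monomial w m ((1 - m%:R / k.+1%:R)%:C *: coef w T m).

Lemma cesaro_inner w T k (x y : H) j l : unitary w -> toeplitz T ->
  inner (cesaro w T k (tens x j)) (tens y l) =
  (k.+1%:R^-1 *+ (k.+1 - (l - j)))%:C * inner (T (tens x j)) (tens y l).
Proof.
move=> wu Tt; rewrite /cesaro bop_sumE inner_suml toeplitz_inner//.
under eq_bigr do rewrite monomialZ bopZE innerZl monomial_coefE// inner_tens.
have [jl|lj] := leqP j l; last first.
  by rewrite mulr0 big1 // => m _; rewrite ifN ?mulr0//; lia.
have [lk|kl] := ltnP (l - j) k.+1; last first.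
  rewrite (_ : (k.+1 - (l - j))%N = 0%N); last by lia.
  by rewrite mulr0n mul0r big1 // => m _; rewrite ifN ?mulr0//; have := ltn_ord m; lia.
rewrite (bigD1 (Ordinal lk))//= subnKC// eqxx big1 ?addr0.
  congr (_%:C * _); rewrite -[RHS]mulr_natr (natrB _ (ltnW lk)) mulrBr mulVf ?pnatr_eq0//.
  by rewrite mulrC.
move=> m mk; rewrite ifN ?mulr0//; apply: contra mk => /eqP E.
by apply/eqP/val_inj => /=; lia.
Qed.

(* Each entry on the diagonal [d] is seen by [N - d] of the windows of length *)
(* [N], which gives the Fejer weight [1 - d / N].                             *)
Lemma cesaro_form w T k x y : unitary w -> toeplitz T ->
  inner (cesaro w T k x) y =
  (k.+1%:R^-1)%:C * inner (rho T (windows k.+1 x)) (windows k.+1 y).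
Proof.
move=> wu Tt; have [C C0 TC] := bop_form_bound T.
have [D D0 cD] := bop_form_bound (cesaro w T k).
apply: (@biadd_tens_eq _ _ _ (fun x y => inner (cesaro w T k x) y) (fun x y =>
  (k.+1%:R^-1)%:C * inner (rho T (windows k.+1 x)) (windows k.+1 y)) D C).
- by move=> a b c; rewrite raddfD innerDl.
- by move=> a b c; rewrite innerDr.
- exact: cD.
- by move=> a b c; rewrite windowsD raddfD innerDl mulrDr.
- by move=> a b c; rewrite windowsD innerDr mulrDr.
- move=> a b; rewrite normrM normc_def /= expr0n addr0 sqrtr_sqr.
  rewrite ger0_norm ?invr_ge0//.
  apply: le_trans (ler_wpM2l _ (windows_form_le k.+1 C0 TC a b)) _.
    by rewrite lecR invr_ge0.
  by rewrite -rmorphM lecR !mulrA mulVf ?pnatr_eq0// mul1r.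
- move=> a n b m; rewrite cesaro_inner// windows_form//.
  by rewrite rmorphMn /= mulrnAl mulrnAr.
Qed.

(** By [cesaro_form] every mean obeys the bound of [T]: the factor 1 / (k + 1) cancels the
    multiplicity of the windows. An entry on the diagonal d is off by d / (k + 1) times itself once
    k >= d. *)
Lemma cesaro_cvg w T : unitary w -> toeplitz T ->
  cesaro w T @ \oo --> (T : wstar (ell2 H)).
Proof.
move=> wu Tt; have [C C0 TC] := bop_form_bound T.
apply: (wstar_bounded_cvg C0).
  apply: nearW => k u v; rewrite cesaro_form// normrM normc_def /= expr0n addr0 sqrtr_sqr.
  rewrite ger0_norm ?invr_ge0//.
  apply: le_trans (ler_wpM2l _ (windows_form_le k.+1 C0 TC u v)) _.
    by rewrite lecR invr_ge0.
  by rewrite -rmorphM lecR !mulrA mulVf ?pnatr_eq0// mul1r.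
move=> x j y l.
have [tau tE] : exists tau : R, `|inner (T (tens x j)) (tens y l)| = tau%:C.
  by eexists; exact: (@rnormE _ R[i]^o).
apply/(iffLR (@subr_cvg0 R[i] R[i]^o _ _ _ _ _))/cvgC0P => d d0.
have /cvgrPdist_lt/(_ _ d0) :
    (fun k : nat => harmonic k * ((l - j)%:R * tau)) @ \oo --> (0 : R).
  by rewrite -[X in _ --> X](mul0r ((l - j)%:R * tau)); apply: cvgMl; exact: cvg_harmonic.
apply: filterS2 (nbhs_infty_ge (l - j)) => k kl.
rewrite sub0r normrN /harmonic /= => kd.
rewrite cesaro_inner// -[X in _ - X]mul1r -mulrBl normrM tE.
rewrite (_ : _ - 1 = (- (k.+1%:R^-1 * (l - j)%:R))%:C).
  rewrite normc_def /= expr0n addr0 sqrtr_sqr -rmorphM ltcR normrN.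
  apply: le_lt_trans kd; rewrite [in leRHS]mulrA [leRHS]normrM; apply: ler_wpM2l => //.
  by rewrite ler_norm.
rewrite -(rmorph1 (real_complex R)) -rmorphB; congr _%:C.
rewrite -[_ *+ _]mulr_natr (natrB _ (leqW kl)) mulrBr mulVf ?pnatr_eq0//; ring.
Qed.
End Cesaro.

(** * Reflexive covers *)

Section Kernel.
Variables (R : realType) (H : hilbertType R).
Implicit Types (u e : ell2 H) (y : H).

Lemma geometric_le (q : R) N : 0 <= q <= 1 / 2 -> \sum_(n < N) q ^+ n <= 2.
Proof.
move=> /andP[q0 q2]; have q1 : 0 < 1 - q by lra.
rewrite -(ler_pM2l q1).
have -> : (1 - q) * \sum_(n < N) q ^+ n = 1 - q ^+ N.
  by rewrite -[LHS]opprK -mulNr opprB -subrX1 opprB.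
have := exprn_ge0 N q0; lra.
Qed.

Lemma szego_partial (l : R) y N : 0 <= l <= 1 / 2 ->
  \sum_(n < N) rnorm ((l ^+ n)%:C *: y) ^+ 2 <= (2 * rnorm y) ^+ 2.
Proof.
move=> /andP[l0 l2].
have E n : rnorm ((l ^+ n)%:C *: y) ^+ 2 = (l ^+ 2) ^+ n * rnorm y ^+ 2.
  rewrite rnormZ normc_def /= expr0n addr0 sqrtr_sqr exprMn real_normK ?num_real//.
  by rewrite exprAC.
under eq_bigr do rewrite E.
rewrite -mulr_suml exprMn ler_wpM2r ?sqr_ge0//.
apply: (@le_trans _ _ 2); last by lra.
by apply: geometric_le; rewrite sqr_ge0 expr2; nra.
Qed.

Lemma szego_summable (l : R) y :
  `[< sq_summable (fun n => if 0 <= l <= 1 / 2 then (l ^+ n)%:C *: y else 0) >].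
Proof.
apply/asboolP; apply: (@sq_summable_bounded _ _ _ ((2 * rnorm y) ^+ 2)) => N.
case: (boolP (0 <= l <= 1 / 2)) => [l2|_]; first exact: szego_partial.
by rewrite big1 ?sqr_ge0// => i _; rewrite rnorm0 expr0n.
Qed.

(* The Szego kernel [sum_n l ^ n e_n] at the real point [l], tensored with [y]; *)
(* outside [0, 1/2] it is set to [0].                                           *)
Definition szego (l : R) y : ell2 H := Ell2 (szego_summable l y).

Lemma rnorm_szego (l : R) y : rnorm (szego l y) <= 2 * rnorm y.
Proof.
apply: ell2_rnorm_le => [|N] /=; first by rewrite mulr_ge0// rnorm_ge0.
case: (boolP (0 <= l <= 1 / 2)) => [l2|_]; first exact: szego_partial.
by rewrite big1 ?sqr_ge0// => i _; rewrite rnorm0 expr0n.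
Qed.

(** The kernel is an eigenvector of the backward shift, with eigenvalue [l]; as [l] is real, no
    conjugate appears. *)
Lemma inner_shift_szego (l : R) u y :
  inner (shift_tens 1 u) (szego l y) = l%:C * inner u (szego l y).
Proof.
have [l2|l2] := boolP (0 <= l <= 1 / 2); last first.
  have -> : szego l y = 0 by apply: ell2_eqP => n /=; rewrite (negbTE l2).
  by rewrite !inner0r mulr0.
have := @ell2_cvg _ _ (shift_tens 1 u) (szego l y).
(* The shifted vector has zero head, so its partial sums of length N + 1 match those of [u] of
   length N. *)
rewrite -(cvg_shiftS (fun N => _)) => hs.
apply: (cvg_unique (@norm_hausdorff _ R[i]^o) hs).
rewrite (_ : (fun N => _) = fun N => l%:C * \sum_(n < N) inner (u n) (szego l y n)).
  by apply: cvgMl_tmp; exact: ell2_cvg.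
apply/funext => N; rewrite big_ord_recl /= inner0l add0r mulr_sumr.
apply: eq_bigr => n _; rewrite /bump /= l2 add1n exprS rmorphM /= !innerZr.
rewrite rmorphM mulrA /=; congr (_ * _ * _).
by apply/conj_Creal/ger0_real; rewrite lecR; case/andP: l2.
Qed.

Lemma inner_shiftX_szego (l : R) u y n :
  inner ((shift_tens 1 ^+ n) u) (szego l y) = (l ^+ n)%:C * inner u (szego l y).
Proof.
elim: n => [|n IH]; first by rewrite !expr0 mul1r.
by rewrite !exprS bopME inner_shift_szego IH mulrA -rmorphM.
Qed.

Lemma tail_summable u : `[< sq_summable (fun n => u n.+1) >].
Proof.
apply/asboolP; apply: (@sq_summable_bounded _ _ _ (rnorm u ^+ 2)) => N.
by apply: le_trans (ell2_partial u N.+1); rewrite big_ord_recl lerDr sqr_ge0.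
Qed.

Definition tail u : ell2 H := Ell2 (tail_summable u).

Lemma head_tail u : u = tens (u 0) 0 + shift_tens 1 (tail u).
Proof. by apply: ell2_eqP => -[|n]; rewrite ell2D /= ?addr0 ?add0r. Qed.

(** Splitting off the head of [u] turns the hypothesis into 0 = <u_0, y> + l <tail u, k_l>, where
    k_l is [szego l y]; its norm is bounded uniformly in [l], and [l] tends to 0. *)
Lemma szego_head u :
  (forall l : R, 0 < l <= 1 / 2 -> forall y, inner u (szego l y) = 0) -> u 0 = 0.
Proof.
move=> u0.
  apply: inner_ext => y; rewrite inner0l.
  have bound (l : R) : 0 < l <= 1 / 2 ->
      `|inner (u 0) y| <= (l * (rnorm (tail u) * (2 * rnorm y)))%:C.
    move=> /[dup] l2 /u0/(_ y); rewrite {1}(head_tail u) innerDl.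
    rewrite inner_tensl inner_shift_szego.
    case/andP: l2 => l0 l2.
    rewrite (_ : szego l y 0 = y); last by rewrite /= (ltW l0) l2 expr0 scale1r.
    move=> /eqP; rewrite addr_eq0 => /eqP ->; rewrite normrN normrM rmorphM.
    rewrite normc_def /= expr0n addr0 sqrtr_sqr gtr0_norm//.
    apply: ler_wpM2l; first by rewrite lecR ltW.
    apply: le_trans (inner_bound _ _) _; rewrite lecR.
    by apply: ler_wpM2l; [exact: rnorm_ge0|exact: rnorm_szego].
  set D := rnorm (tail u) * _ in bound.
  have D0 : 0 <= D by rewrite !mulr_ge0// rnorm_ge0.
  apply/eqP; rewrite -normr_eq0; apply/eqP.
  rewrite (@rnormE _ R[i]^o); congr _%:C; apply/eqP; rewrite eq_le rnorm_ge0 andbT.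
  apply/ler_addgt0Pl => e e0; rewrite addr0.
  have [l [l0 l2 le]] : exists l : R, [/\ 0 < l, l <= 1 / 2 & l * D <= e].
    (* The first term keeps [l] in range, the second makes l D at most e; adding 1 guards against D
       = 0. *)
    exists (Num.min (1 / 2) (e / (D + 1))); split.
    - by rewrite lt_min; apply/andP; split; [lra|rewrite divr_gt0// ltr_wpDl].
    - by rewrite ge_min lexx.
    - apply: (@le_trans _ _ (e / (D + 1) * D)).
        by rewrite ler_wpM2r// ge_min lexx orbT.
      by rewrite mulrAC ler_pdivrMr ?ltr_wpDl//; apply: ler_wpM2l; rewrite ?ltW// ltrDl.
  apply: le_trans le; rewrite -lecR -(@rnormE _ R[i]^o); apply: bound.
  by rewrite l0.
Qed.

(** Once the head is 0, the factor l > 0 cancels and the tail of [u] satisfies the same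
    hypothesis. *)
Lemma szego_total u :
  (forall l : R, 0 < l <= 1 / 2 -> forall y, inner u (szego l y) = 0) -> u = 0.
Proof.
move=> u0; apply: ell2_eqP => n; elim: n u u0 => [|n IH] u u0; first exact: szego_head.
rewrite -[LHS]/(tail u n) IH// => l l2 y.
have := u0 l l2 y; rewrite {1}(head_tail u) (szego_head u0) innerDl inner_tensl inner0l.
rewrite add0r inner_shift_szego => /eqP; rewrite mulf_eq0 => /orP[|/eqP//].
by move/eqP/(congr1 (@complex.Re R)) => /= l0; move: l2; rewrite l0 ltxx.
Qed.

End Kernel.

Section Reflexive.
Variables (R : realType).

Lemma closure_rnormP (H : hilbertType R) (A : set H) u :
  closure A u <-> forall e : R, 0 < e -> exists2 a, A a & rnorm (u - a) < e.
Proof.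
split=> [cA e e0|hA B].
  have := cA (ball u e%:C); case.
    by apply: nbhsx_ballx; rewrite ltcR.
  by move=> a [Aa]; rewrite ball_rnorm => ua; exists a.
move=> /nbhs_ballP[_ /gt0_complex[e e0 ->] eB]; have [a Aa ua] := hA e e0.
by exists a; split => //; apply: eB; rewrite ball_rnorm.
Qed.

Lemma Ref_sub (H : hilbertType R) (S : set (bop H)) : S `<=` Ref S.
Proof. by move=> T ST x; apply: subset_closure; exists T. Qed.

(** The cover controls [T] at one vector at a time, so the linear conditions that pass to it are
    those tested on one [x] and one [y]. *)
Lemma Ref_inner (H : hilbertType R) (S : set (bop H)) T (x y : H) : Ref S T ->
  (forall B, S B -> inner (B x) y = 0) -> inner (T x) y = 0.
Proof.
move=> /(_ x)/closure_rnormP Tx S0.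
apply/eqP; rewrite -normr_eq0; apply/eqP.
rewrite (@rnormE _ R[i]^o); congr _%:C; apply/eqP; rewrite eq_le rnorm_ge0 andbT.
apply/ler_addgt0Pl => e e0; rewrite addr0.
have y1 : 0 < rnorm y + 1 by rewrite ltr_wpDl// rnorm_ge0.
have [_ [B SB <-] TB] := Tx _ (divr_gt0 e0 y1).
rewrite -lecR -(@rnormE _ R[i]^o) -[inner _ _]subr0 -(S0 _ SB) -innerBl.
apply: le_trans (inner_bound _ _) _; rewrite lecR.
apply: (@le_trans _ _ (e / (rnorm y + 1) * rnorm y)).
  by apply: ler_wpM2r; [exact: rnorm_ge0|exact: ltW].
by rewrite mulrAC ler_pdivrMr//; apply: ler_wpM2l; rewrite ?ltW// ltrDl.
Qed.

Variable H : hilbertType R.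
Implicit Types (S : set (bop (ell2 H))) (A : set (bop H)) (w : bop H).

Lemma toeplitz_shift (T : bop (ell2 H)) x j : toeplitz T ->
  T (tens x j) = (shift_tens 1 ^+ j) (T (tens x 0)).
Proof.
move=> Tt; apply: ell2_eqP => i; rewrite Tt shiftXE; case: ifP => // _.
by rewrite expr1n bop1E.
Qed.

(** For Toeplitz [B], the vector B (x (x) e_j - l^j x (x) e_0) is orthogonal to the kernel at [l].
    [Ref_inner] transfers this to [T], and totality of the kernels gives back T (x (x) e_j) as the
    j-th shift of T (x (x) e_0). *)
Lemma Ref_toeplitz S T : S `<=` @toeplitz R H -> Ref S T -> toeplitz T.
Proof.
move=> St RT x j i.
suff -> : T (tens x j) = (shift_tens 1 ^+ j) (T (tens x 0)).
  by rewrite shiftXE; case: ifP => // _; rewrite expr1n bop1E.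
apply/subr0_eq/szego_total => l l2 y; rewrite innerBl inner_shiftX_szego -innerZl -innerBl.
rewrite -linearZ -raddfB; apply: (Ref_inner RT) => B SB.
rewrite raddfB /= linearZ innerBl innerZl (toeplitz_shift x j (St B SB)).
by rewrite inner_shiftX_szego subrr.
Qed.

(** The coefficient at [x] is a bounded linear image of T (x (x) e_0): read coordinate [m], then
    apply w^m. Approximation at this single vector therefore suffices. *)
Lemma Ref_coef w S T m x : Ref S T ->
  closure [set coef w B m x | B in S] (coef w T m x).
Proof.
move=> /(_ (tens x 0))/closure_rnormP RT; apply/closure_rnormP => e e0.
have [C C0 wC] := bop_ge0_bound (w ^+ m).
have C1 : 0 < C + 1 by rewrite ltr_wpDl.
have [_ [B SB <-] TB] := RT _ (divr_gt0 e0 C1).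
exists (coef w B m x); first by exists B.
rewrite /coef !bopME -raddfB; apply: le_lt_trans (wC _) _.
apply: (@le_lt_trans _ _ (C * (e / (C + 1)))).
  apply: ler_wpM2l => //; apply: le_trans (ltW TB).
  exact: (ell2_coord_le (T (tens x 0) - B (tens x 0)) m).
by rewrite mulrCA gtr_pMr// ltr_pdivrMr// mul1r ltrDl.
Qed.

Lemma closure_toeplitz S : S `<=` @toeplitz R H -> wstar_closure S `<=` @toeplitz R H.
Proof.
move=> St T ST x j i; apply: inner_ext => y.
(* One vector for both branches of [toeplitz], which brings either into the form of
   [wstar_closed_eq]. *)
pose u := if (j <= i)%N then tens x 0 else 0.
have key (B : bop (ell2 H)) : inner (B u) (tens y (i - j)%N) =
    inner (if (j <= i)%N then B (tens x 0) (i - j)%N else 0) y.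
  rewrite /u; case: ifP => _; first by rewrite inner_tensr.
  by rewrite raddf0 !inner0l.
rewrite -key -inner_tensr.
apply: (wstar_closure_min _ (@wstar_closed_eq _ _ (tens x j) (tens y i) u _)) ST.
move=> B SB; change (inner (B (tens x j)) (tens y i) = inner (B u) (tens y (i - j)%N)).
by rewrite key inner_tensr (St B SB x j i).
Qed.

Lemma ell2_inner_eq (K : hilbertType R) (x y : ell2 H) (x' y' : ell2 K) :
  (forall n, inner (x n) (y n) = inner (x' n) (y' n)) -> inner x y = inner x' y'.
Proof.
move=> E; apply: (cvg_unique (@norm_hausdorff _ R[i]^o) (@ell2_cvg _ _ x y)).
rewrite (_ : (fun N => _) = fun N => \sum_(n < N) inner (x' n) (y' n)).
  exact: ell2_cvg.
by apply/funext => N; apply: eq_bigr.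
Qed.

Lemma slot_summable (x : ell2 H) m : `[< sq_summable (fun n => tens (x n) m) >].
Proof.
apply/asboolP; rewrite /sq_summable; under eq_fun do rewrite rnorm_tens.
exact: ell2P.
Qed.

Definition slot (x : ell2 H) m : ell2 (ell2 H) := Ell2 (slot_summable x m).

(** After w^m is moved across the inner product, the pulled-back functional pairs [T] with the
    sequences having x_n in slot 0 and (adjoint w)^m y_n in slot m. *)
Lemma wstar_closed_coef w A m : unitary w -> wstar_closed A ->
  wstar_closed [set T | A (coef w T m)].
Proof.
move=> wu; apply: (@wstar_closed_preimage _ _ _ (fun T => coef w T m)) => x y.
exists (slot x 0), (slot (rho (adjoint w ^+ m) y) m) => T.
apply: ell2_inner_eq => n; rewrite -[rho _ x n]/(coef w T m (x n)) /coef bopME.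
rewrite (is_adjointX m (unitary_is_adjoint wu)).
by rewrite -[RHS]/(inner (T (tens (x n) 0)) (tens ((adjoint w ^+ m) (y n)) m)) inner_tensr.
Qed.

End Reflexive.

(** * Continuity of the monomial maps for the w*-topologies *)

Section Flatten.
Variables (R : realType) (H : hilbertType R).
Implicit Types (x y : ell2 (ell2 H)).

(** [pickle_inv] returns a pair only at its own code, so each entry of [x] is listed at most
    once. *)
Definition flat_fun m x n : H :=
  if @pickle_inv (nat * nat)%type n is Some p then x p.1 (p.2 + m)%N else 0.

Lemma flat_partial m x N : \sum_(n < N) rnorm (flat_fun m x n) ^+ 2 <= rnorm x ^+ 2.
Proof.
pose f (p : nat * nat) := rnorm (x p.1 (p.2 + m)%N) ^+ 2.
have f0 p : 0 <= f p by rewrite sqr_ge0.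
(* The square of side [L] contains every pair coded below N. *)
pose L := \max_(n < N)
  if @pickle_inv (nat * nat)%type n is Some p then (p.1 + p.2).+1 else 0%N.
have fE (n : 'I_N) : rnorm (flat_fun m x n) ^+ 2 =
    \sum_(p : 'I_L * 'I_L | pickle (nat_of_ord p.1, nat_of_ord p.2) == n)
      f (nat_of_ord p.1, nat_of_ord p.2).
  rewrite /flat_fun; case E: (pickle_inv n) => [[i k]|]; last first.
    rewrite rnorm0 expr0n big1// => p /eqP pn.
    by rewrite -pn pickleK_inv in E.
  have nE : pickle (i, k) = n by have := @pickle_invK (nat * nat)%type n; rewrite E.
  have ikL : ((i + k).+1 <= L)%N.
    by rewrite /L (bigD1 n)//= E leq_maxl.
  have iL : (i < L)%N by lia.
  have kL : (k < L)%N by lia.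
  rewrite (bigD1 (Ordinal iL, Ordinal kL)) /= ?nE// big1 ?addr0// => -[p q] /=.
  move=> /andP[/eqP pn]; rewrite -nE in pn.
  by have [pi qk] := pcan_inj pickleK pn => /eqP[]; congr (_, _); apply: val_inj.
under eq_bigr do rewrite fE.
rewrite (exchange_big_dep xpredT)//=.
apply: (@le_trans _ _ (\sum_(p : 'I_L * 'I_L) f (nat_of_ord p.1, nat_of_ord p.2))).
  apply: ler_sum => p _.
  have [pN|pN] := ltnP (pickle (nat_of_ord p.1, nat_of_ord p.2)) N; last first.
    by rewrite big1 // => i /eqP pi; rewrite pi leqNgt ltn_ord in pN.
  by rewrite (big_pred1 (Ordinal pN)).
rewrite -(pair_big xpredT xpredT (fun i k : 'I_L => f (nat_of_ord i, nat_of_ord k))) /=.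
apply: le_trans (ell2_partial x L); apply: ler_sum => i _.
apply: le_trans (ell2_partial (x i) (m + L)).
rewrite big_split_ord /=; apply: ler_wpDl.
  by apply: sumr_ge0 => k _; rewrite sqr_ge0.
by apply: ler_sum => k _; rewrite /f /= addnC.
Qed.

Lemma flat_summable m x : `[< sq_summable (flat_fun m x) >].
Proof. apply/asboolP; apply: sq_summable_bounded; exact: flat_partial. Qed.

(* Concatenates the tails [(x i k)_(k >= m)] into one sequence, along the     *)
(* pairing [pickle]; this turns the w*-functionals of [ell2 H] applied to an  *)
(* amplification into w*-functionals of [H].                                  *)
Definition flat m x : ell2 H := Ell2 (flat_summable m x).

Lemma rnorm_flat m x : rnorm (flat m x) <= rnorm x.
Proof. by apply: ell2_rnorm_le; [exact: rnorm_ge0|exact: flat_partial]. Qed.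

Lemma flatD m x y : flat m (x + y) = flat m x + flat m y.
Proof.
apply: ell2_eqP => n; rewrite ell2D /= /flat_fun.
by case: pickle_inv => [p|]; rewrite ?addr0.
Qed.

Lemma flat_tens m (a : H) k i : flat m (tens (tens a k) i) =
  if (m <= k)%N then tens a (pickle (i, (k - m)%N)) else 0.
Proof.
apply: ell2_eqP => n; rewrite /= /flat_fun /=.
case E: (pickle_inv n) => [[i' k']|]; last first.
  case: ifP => //= _; case: eqP => // nE; by rewrite nE pickleK_inv in E.
have nE : pickle (i', k') = n by have := @pickle_invK (nat * nat)%type n; rewrite E.
have nn p : (n == pickle p) = ((i', k') == p) by rewrite -nE (inj_eq (pcan_inj pickleK)).
have [mk|km] := leqP m k.
  rewrite /= nn -pair_eqE /=; case: (i' == i) => //=.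
  by rewrite (_ : (k' + m == k)%N = (k' == (k - m)%N)) //; move: (k' : nat) => q; lia.
case: ifP => //= _; rewrite ifN//; move: (k' : nat) => q; lia.
Qed.

End Flatten.

Section MonomialContinuous.
Variables (R : realType) (H : hilbertType R).

(** Both sides are the sum over i and k of <b x_{i,k}, w^m y_{i,k+m}>. As bounded biadditive forms
    they need comparison only on tensors of tensors, whence the two uses of [biadd_tens_eq]. *)
Lemma monomial_rho_flat (w b : bop H) m (x y : ell2 (ell2 H)) : unitary w ->
  inner (rho (monomial w m b) x) y =
  inner (rho b (flat 0 x)) (rho (w ^+ m) (flat m y)).
Proof.
move=> wu.
pose B x y := inner (rho (monomial w m b) x) y.
pose B' x y := inner (rho b (flat 0 x)) (rho (w ^+ m) (flat m y)).
have [C C0 BC] : exists2 C : R, 0 <= C &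
    forall x y, `|B x y| <= (C * rnorm x * rnorm y)%:C.
  exact: bop_form_bound.
have [C' C'0 BC'] : exists2 C : R, 0 <= C &
    forall x y, `|B' x y| <= (C * rnorm x * rnorm y)%:C.
  have [C1 C10 bC1] := bop_ge0_bound (rho b).
  have [C2 C20 bC2] := bop_ge0_bound (rho (w ^+ m)).
  exists (C1 * C2); first exact: mulr_ge0.
  move=> u v; apply: le_trans (inner_bound _ _) _; rewrite lecR.
  rewrite -mulrA mulrACA; apply: ler_pM; try exact: rnorm_ge0.
    apply: le_trans (bC1 _) _; apply: ler_wpM2l => //; exact: rnorm_flat.
  apply: le_trans (bC2 _) _; apply: ler_wpM2l => //; exact: rnorm_flat.
have BDl a a' c : B (a + a') c = B a c + B a' c by rewrite /B raddfD innerDl.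
have BDr a c c' : B a (c + c') = B a c + B a c' by rewrite /B innerDr.
have BDl' a a' c : B' (a + a') c = B' a c + B' a' c by rewrite /B' flatD raddfD innerDl.
have BDr' a c c' : B' a (c + c') = B' a c + B' a c' by rewrite /B' flatD raddfD innerDr.
apply: (biadd_tens_eq BDl BDr BC BDl' BDr' BC') => {}x i {}y j.
have tensB K (D : R) :
    (forall x y : ell2 (ell2 H), `|K x y| <= (D * rnorm x * rnorm y)%:C) ->
    forall u v, `|K (tens u i) (tens v j)| <= (D * rnorm u * rnorm v)%:C.
  by move=> KD u v; have := KD (tens u i) (tens v j); rewrite !rnorm_tens.
apply: (@biadd_tens_eq _ _ _ (fun x y => B (tens x i) (tens y j))
  (fun x y => B' (tens x i) (tens y j)) C C').
- by move=> a a' c; rewrite tensD BDl.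
- by move=> a a' c; rewrite tensD BDr.
- exact: tensB.
- by move=> a a' c; rewrite tensD BDl'.
- by move=> a a' c; rewrite tensD BDr'.
- exact: tensB.
move=> a k c l; rewrite /B /B' !flat_tens leq0n subn0 !rho_tens monomial_tens inner_tens.
case: (leqP m l) => ml; last first.
  rewrite raddf0 inner0r; case: ifP => // _; rewrite inner_tens ifN//; lia.
rewrite rho_tens !inner_tens (inj_eq (pcan_inj pickleK)) -pair_eqE /=.
rewrite (_ : (k + m == l)%N = (k == (l - m)%N)); last by lia.
case: (i == j) => //=; case: ifP => // _.
by rewrite innerC [RHS]innerC (is_adjointX m (unitary_is_adjoint wu)).
Qed.

Lemma wstar_closed_monomial (w : bop H) m S : unitary w -> wstar_closed S ->
  wstar_closed [set b | S (monomial w m b)].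
Proof.
move=> wu; apply: wstar_closed_preimage => x y.
by exists (flat 0 x), (rho (w ^+ m) (flat m y)) => b; exact: monomial_rho_flat.
Qed.
End MonomialContinuous.

(** * Fourier coefficients *)

Section Partitions.
Variables (R : realType) (a b : R) (ab : a <= b).

Lemma tp_point_le P i : is_tagged_partition a b P -> (i < tp_size P)%N ->
  tp_point P i <= tp_point P i.+1.
Proof. by move=> [_ _ h] /h /andP[/le_trans]; apply. Qed.

Lemma sum_mesh (P : tagged_partition R) : is_tagged_partition a b P ->
  \sum_(i < tp_size P) (tp_point P i.+1 - tp_point P i) = b - a.
Proof.
move=> [pa pb _].
rewrite -(big_mkord xpredT (fun i => tp_point P i.+1 - tp_point P i)).
by rewrite telescope_sumr// pa pb.
Qed.

(** The uniform partition; its existence makes the filter proper. *)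
Lemma fine_partition_exists (d : R) : 0 < d ->
  exists P, is_tagged_partition a b P /\ mesh_lt d P.
Proof.
move=> d0; pose N := (Num.truncn ((b - a) / d)).+1.
have N0 : 0 < N%:R :> R by rewrite ltr0n.
have h0 : 0 <= (b - a) / N%:R by rewrite divr_ge0 ?subr_ge0.
have step (i : nat) : (a + i.+1%:R * ((b - a) / N%:R)) -
    (a + i%:R * ((b - a) / N%:R)) = (b - a) / N%:R.
  by rewrite -natr1; ring.
exists (TaggedPartition N (fun i => a + i%:R * ((b - a) / N%:R))
  (fun i => a + i%:R * ((b - a) / N%:R))); split.
  split => /= [||i _]; first by rewrite mul0r addr0.
    by rewrite mulrC divfK ?gt_eqF// addrC subrK.
  by rewrite lexx -subr_ge0 step.
move=> i _ /=; rewrite step ltr_pdivrMr// mulrC -ltr_pdivrMr//.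
exact: truncnS_gt.
Qed.

Lemma fine_partitions_filter : ProperFilter (fine_partitions a b).
Proof.
apply: filter_from_proper; last first.
  by move=> d d0; have [P HP] := fine_partition_exists d0; exists P.
apply: filter_from_filter; first by exists 1 => /=.
move=> d e /= d0 e0; exists (Num.min d e); first by rewrite /= lt_min d0.
move=> P [tP mP]; split; split=> // i /mP; rewrite lt_min => /andP[]//.
Qed.

(* By the mean value theorem on each interval the Riemann sum differs from    *)
(* the telescoping sum of [F] by at most [L * mesh * (b - a)].                *)
Lemma riemann_antiderivative (F f : R -> R) (L : R) : 0 <= L ->
  (forall x : R, is_derive x 1 F (f x)) ->
  (forall x y, `|f x - f y| <= L * `|x - y|) ->
  (fun P : tagged_partition R =>
    \sum_(i < tp_size P) (tp_point P i.+1 - tp_point P i) * f (tp_tag P i))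
  @ fine_partitions a b --> F b - F a.
Proof.
have FF := fine_partitions_filter.
move=> L0 Ff fL; apply/cvgrPdist_lt => e e0.
have K0 : 0 < L * (b - a) + 1 by rewrite ltr_wpDl// mulr_ge0// subr_ge0.
exists (e / (L * (b - a) + 1)) => /=; first by rewrite divr_gt0.
set d := e / _ => P [tP mP].
have [pa pb tag] := tP.
rewrite -{1}pb -{1}pa -(telescope_sumr (fun i => F (tp_point P i)))// big_mkord -sumrB.
apply: le_lt_trans (ler_norm_sum _ _ _) _.
apply: (@le_lt_trans _ _ (\sum_(i < tp_size P) (tp_point P i.+1 - tp_point P i) * (L * d))).
  apply: ler_sum => i _; have pp := tp_point_le tP (ltn_ord i).
  have [c cI ->] : exists2 c, c \in `[tp_point P i, tp_point P i.+1] &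
      F (tp_point P i.+1) - F (tp_point P i) = f c * (tp_point P i.+1 - tp_point P i).
    apply: MVT_segment => //; apply: derivable_within_continuous => x _.
    exact: ex_derive.
  rewrite mulrC -mulrBr normrM ger0_norm ?subr_ge0//.
  apply: ler_wpM2l; first by rewrite subr_ge0.
  apply: le_trans (fL _ _) _; apply: ler_wpM2l => //.
  have /andP[t1 t2] := tag i (ltn_ord i); have := mP i (ltn_ord i).
  move: cI; rewrite in_itv /= => /andP[c1 c2] dd.
  rewrite ler_norml; apply/andP; split; lra.
rewrite -mulr_suml sum_mesh// /d.
rewrite (_ : _ * _ = L * (b - a) / (L * (b - a) + 1) * e); last by ring.
by rewrite gtr_pMl// ltr_pdivrMr// mul1r ltrDl.
Qed.

End Partitions.

Section Cis.
Variable R : realType.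

Lemma cisD (s t : R) : cis (s + t) = cis s * cis t.
Proof.
apply/eqP; rewrite eq_complex /= cosD sinD; apply/andP; split; apply/eqP => //.
by rewrite addrC [sin s * _]mulrC mulrC.
Qed.

Lemma cis0 : cis (0 : R) = 1.
Proof. by rewrite /cis cos0 sin0. Qed.

Lemma conj_cis (s : R) : Num.conj (cis s) = cis (- s).
Proof. by apply/eqP; rewrite eq_complex /= cosN sinN !eqxx. Qed.

Lemma cis_period (k : int) : cis (k%:~R * (2 * pi)) = 1 :> R[i].
Proof.
have nat_period (n : nat) : cis (n%:R * (2 * pi)) = 1 :> R[i].
  elim: n => [|n IH]; first by rewrite mul0r cis0.
  by rewrite -natr1 mulrDl cisD IH !mul1r mulr_natl /cis sin2pi cos2pi.
case: k => n; first exact: nat_period.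
by rewrite NegzE mulrNz mulNr -conj_cis nat_period rmorph1.
Qed.

Lemma lip_of_derive (f df : R -> R) : (forall x : R, is_derive x 1 f (df x)) ->
  (forall x, `|df x| <= 1) -> forall x y, `|f x - f y| <= `|x - y|.
Proof.
move=> fd df1 x y; wlog xy : x y / y <= x.
  by move=> W; have [/W//|/ltW/W] := leP y x; rewrite distrC [X in _ <= X]distrC.
have [c _ ->] : exists2 c, c \in `[y, x] & f x - f y = df c * (x - y).
  apply: MVT_segment => //; apply: derivable_within_continuous => z _.
  exact: ex_derive.
by rewrite normrM ler_piMl.
Qed.

Lemma sin_max (x : R) : `|sin x| <= 1.
Proof. by rewrite -cosBpihalf cos_max. Qed.

Lemma is_derive_dilate (f df : R -> R) (k x : R) :
  (forall x : R, is_derive x 1 f (df x)) ->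
  is_derive x 1 (fun s => f (k * s)) (k * df (k * x)).
Proof.
move=> fd; rewrite mulrC.
have gd : is_derive x 1 (fun s : R => k * s) k.
  apply: (is_derive_eq (@is_deriveZ R R^o R^o id k x 1 1 (is_derive_id x 1))).
  exact: mulr1.
exact: (@is_derive1_comp R f (fun s => k * s) x _ _ (fd (k * x)) gd).
Qed.

Lemma cvg_complex I (F : set_system I) {FF : Filter F} (f g : I -> R) (a b : R) :
  f @ F --> a -> g @ F --> b ->
  (fun i => f i +i* g i) @ F --> ((a +i* b) : R[i]^o).
Proof.
move=> fa gb; apply: (iffLR (@subr_cvg0 R[i] R[i]^o _ _ _ _ _)).
apply/cvgC0P => e e0; have e2 : 0 < e / 2 by rewrite divr_gt0.
have /cvgrPdist_lt/(_ _ e2) := fa; have /cvgrPdist_lt/(_ _ e2) := gb.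
apply: filterS2 => i gi fi.
have -> : (f i +i* g i) - (a +i* b) = - (a - f i)%:C + (0 +i* - (b - g i)) :> R[i].
  by apply/eqP; rewrite eq_complex /=; apply/andP; split; apply/eqP; ring.
apply: le_lt_trans (ler_normD _ _) _.
rewrite normrN !normc_def /= expr0n /= addr0 add0r !sqrtr_sqr normrN -rmorphD ltcR; lra.
Qed.

(** For k = 0 the integrand is 1. Otherwise sin (K s) / K and - cos (K s) / K are antiderivatives of
    the two parts and agree at 0 and 2 pi. *)
Lemma riemann_cis (k : int) :
  (fun P : tagged_partition R => \sum_(i < tp_size P)
    (tp_point P i.+1 - tp_point P i)%:C * cis (k%:~R * tp_tag P i))
  @ fine_partitions 0 (2 * pi) --> ((if k == 0 then (2 * pi)%:C else 0) : R[i]^o).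
Proof.
have pi0 : 0 <= 2 * pi :> R by rewrite mulr_ge0// pi_ge0.
have FF : Filter (fine_partitions 0 (2 * pi : R)) := fine_partitions_filter pi0.
set K : R := k%:~R.
have -> : (fun P : tagged_partition R => \sum_(i < tp_size P)
    (tp_point P i.+1 - tp_point P i)%:C * cis (K * tp_tag P i)) =
  (fun P =>
    (\sum_(i < tp_size P) (tp_point P i.+1 - tp_point P i) * cos (K * tp_tag P i)) +i*
    (\sum_(i < tp_size P) (tp_point P i.+1 - tp_point P i) * sin (K * tp_tag P i))).
  apply/funext => P; apply/eqP; rewrite eq_complex /= !raddf_sum /=.
  by apply/andP; split; apply/eqP/eq_bigr => i _ /=; ring.
have lip (f df : R -> R) : (forall x : R, is_derive x 1 f (df x)) ->
    (forall x, `|df x| <= 1) ->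
    forall x y, `|f (K * x) - f (K * y)| <= `|K| * `|x - y|.
  by move=> fd df1 x y; rewrite -normrM mulrBr; exact: lip_of_derive fd df1 _ _.
have lipc : forall x y, `|cos (K * x) - cos (K * y)| <= `|K| * `|x - y|.
  by apply: (lip (@cos R) (fun x => - sin x)) => x; rewrite normrN sin_max.
have lips : forall x y, `|sin (K * x) - sin (K * y)| <= `|K| * `|x - y|.
  by apply: (lip (@sin R) (@cos R)) => x; exact: cos_max.
case: eqP => [k0|/eqP k0].
  have K0 : K = 0 by rewrite /K k0.
  apply: cvg_complex.
    rewrite (_ : (fun P => _) = fun P : tagged_partition R =>
        \sum_(i < tp_size P) (tp_point P i.+1 - tp_point P i) * 1); last first.
      by apply/funext => P; apply: eq_bigr => i _; rewrite K0 mul0r cos0.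
    have := @riemann_antiderivative R 0 (2 * pi) pi0 id (fun=> 1) 0 (lexx 0).
    rewrite subr0; apply=> x y.
    by rewrite subrr normr0 mul0r.
  rewrite (_ : (fun P => _) = fun=> 0); first exact: cvg_cst.
  by apply/funext => P; apply: big1 => i _; rewrite K0 mul0r sin0 mulr0.
have K0 : K != 0 by rewrite intr_eq0.
have [c2 s2] : cos (K * (2 * pi)) = 1 /\ sin (K * (2 * pi)) = 0.
  by have [] := cis_period k.
rewrite (_ : 0 = 0 +i* 0 :> R[i])//; apply: cvg_complex.
  have := @riemann_antiderivative R 0 (2 * pi) pi0 (fun s => K^-1 * sin (K * s))
    (fun s => cos (K * s)) `|K| (normr_ge0 _).
  rewrite s2 !mulr0 sin0 mulr0 subr0; apply=> // x.
  have h := is_derive_dilate K x (@is_derive_sin R).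
  by apply: (is_derive_eq (@is_deriveZ R R^o R^o _ K^-1 x 1 _ h)); exact: mulKf.
have := @riemann_antiderivative R 0 (2 * pi) pi0 (fun s => - K^-1 * cos (K * s))
  (fun s => sin (K * s)) `|K| (normr_ge0 _).
rewrite c2 !mulr0 cos0 subrr; apply=> // x.
have h := is_derive_dilate K x (@is_derive_cos R).
apply: (is_derive_eq (@is_deriveZ R R^o R^o _ (- K^-1) x 1 _ h)).
transitivity (- K^-1 * (K * - sin (K * x))) => //.
by rewrite mulrA mulNr mulVf// mulN1r opprK.
Qed.

End Cis.

Section FourierCoef.
Variables (R : realType) (H : hilbertType R).
Implicit Types (T : bop (ell2 H)) (w : bop H).

Lemma phase_is_adjoint (s : R) : is_adjoint (phase H s) (phase H (- s)).
Proof.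
move=> x y; apply: ell2_inner_eq => n.
rewrite -[phase H s x n]/(cis (n%:R * s) *: x n).
rewrite -[phase H (- s) y n]/(cis (n%:R * - s) *: y n).
by rewrite innerZl innerZr conj_cis mulrN opprK.
Qed.

Lemma phase_adjoint (s : R) : adjoint (phase H s) = phase H (- s).
Proof. exact/adjoint_eq/phase_is_adjoint. Qed.

Lemma rnorm_phase (s : R) (x : ell2 H) : rnorm (phase H s x) = rnorm x.
Proof.
apply/eqP; rewrite -(@eqrXn2 _ 2)// ?rnorm_ge0//; apply/eqP/complexI.
rewrite !rmorphXn /= -!rnormE !normr_inner; apply: ell2_inner_eq => n.
rewrite -[phase H s x n]/(cis (n%:R * s) *: x n).
by rewrite innerZl innerZr conj_cis mulrA -cisD subrr cis0 mul1r.
Qed.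

Lemma fourier_integrand_bound T m (s : R) (C : R) :
  (forall u v, `|inner (T u) v| <= (C * rnorm u * rnorm v)%:C) ->
  forall u v, `|inner (fourier_integrand T m s u) v| <= (C * rnorm u * rnorm v)%:C.
Proof.
move=> TC u v; rewrite /fourier_integrand bopZE innerZl normrM normr_cis mul1r.
rewrite phase_adjoint !bopME.
rewrite phase_is_adjoint -(rnorm_phase (- s) u) -(rnorm_phase (- s) v).
exact: TC.
Qed.

Lemma fourier_integrand_tens T m (s : R) x j y i :
  inner (fourier_integrand T m s (tens x j)) (tens y i) =
  cis ((i%:Z - j%:Z - m)%:~R * s) * inner (T (tens x j)) (tens y i).
Proof.
rewrite /fourier_integrand bopZE innerZl phase_adjoint !bopME phase_tens [T (_ *: _)]linearZ.
rewrite !inner_tensr.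
rewrite (_ : phase H s _ i = cis (i%:R * s) *: (cis (j%:R * - s) *: T (tens x j) i))//.
rewrite !innerZl !mulrA -!cisD; congr (cis _ * _).
by rewrite !rmorphB /= -!pmulrn; ring.
Qed.

Lemma riemann_sum_inner (f : R -> bop (ell2 H)) (P : tagged_partition R) x y :
  inner (riemann_sum f P x) y =
  \sum_(i < tp_size P) (tp_point P i.+1 - tp_point P i)%:C * inner (f (tp_tag P i) x) y.
Proof.
rewrite /riemann_sum bop_sumE inner_suml; apply: eq_bigr => i _.
by rewrite bopZE innerZl.
Qed.

Lemma riemann_sum_bound (f : R -> bop (ell2 H)) (a b C : R) P :
  is_tagged_partition a b P ->
  (forall s u v, `|inner (f s u) v| <= (C * rnorm u * rnorm v)%:C) ->
  forall u v, `|inner (riemann_sum f P u) v| <= ((b - a) * C * rnorm u * rnorm v)%:C.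
Proof.
move=> tP fC u v; rewrite riemann_sum_inner -(sum_mesh tP) -!mulrA mulr_suml rmorph_sum.
apply: le_trans (ler_norm_sum _ _ _) _; apply: ler_sum => i _.
have pp := tp_point_le tP (ltn_ord i).
rewrite normrM normc_def /= expr0n addr0 sqrtr_sqr ger0_norm ?subr_ge0// rmorphM /=.
apply: ler_wpM2l; first by rewrite lecR subr_ge0.
by have := fC (tp_tag P i) u v; rewrite -mulrA.
Qed.

(** Entry (i, j) is a Riemann sum of exp (i - j - m) times the imaginary unit and s, scaled by the
    entry of [T], so only the diagonal i - j = m survives. The sums are uniformly bounded, so
    entries decide. *)
Lemma riemann_fourier_cvg w T (m : nat) : unitary w -> toeplitz T ->
  (riemann_sum (fourier_integrand T m) P
    @[P --> fine_partitions 0 (2 * pi)] : set_system (wstar (ell2 H)))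
  --> ((2 * pi)%:C *: monomial w m (coef w T m) : wstar (ell2 H)).
Proof.
move=> wu Tt; have [C C0 TC] := bop_form_bound T.
have pi0 : 0 <= 2 * pi :> R by rewrite mulr_ge0// pi_ge0.
have FF : Filter (fine_partitions 0 (2 * pi : R)) := fine_partitions_filter pi0.
apply: (@wstar_bounded_cvg _ _ _ _ _ _ _ (2 * pi * C)); first exact: mulr_ge0.
  exists 1 => //= P [tP _].
  have := riemann_sum_bound tP (fun s => fourier_integrand_bound m s TC).
  by rewrite subr0.
move=> x j y i.
rewrite bopZE innerZl monomial_coefE// inner_tens.
rewrite (_ : (fun P => _) = fun P : tagged_partition R => (\sum_(k < tp_size P)
    (tp_point P k.+1 - tp_point P k)%:C * cis ((i%:Z - j%:Z - m%:Z)%:~R * tp_tag P k)) *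
    inner (T (tens x j)) (tens y i)); last first.
  apply/funext => P; rewrite riemann_sum_inner mulr_suml; apply: eq_bigr => k _.
  by rewrite fourier_integrand_tens mulrA.
rewrite (_ : (2 * pi)%:C * _ = (if i%:Z - j%:Z - m%:Z == 0 then (2 * pi)%:C else 0) *
    inner (T (tens x j)) (tens y i)).
  by apply: (@cvgMl R[i]); exact: riemann_cis.
rewrite toeplitz_inner//; have [E|E] := eqVneq (j + m)%N i.
  by rewrite -E leq_addr addKn ifT//; lia.
by rewrite mulr0 ifN ?mul0r//; lia.
Qed.

Lemma fourier_coef_toeplitz w T (m : nat) : unitary w -> toeplitz T ->
  fourier_coef T m = monomial w m (coef w T m).
Proof.
move=> wu Tt.
have pi0 : 0 <= 2 * pi :> R by rewrite mulr_ge0// pi_ge0.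
have FF : ProperFilter (fine_partitions 0 (2 * pi : R)) := fine_partitions_filter pi0.
rewrite /fourier_coef (cvg_lim (@wstar_hausdorff _ _) (riemann_fourier_cvg (m := m) wu Tt)).
rewrite scalerA -rmorphM mulVf ?scale1r//.
by rewrite mulf_neq0// gt_eqF// pi_gt0.
Qed.

End FourierCoef.

(** * The semicrossed product *)

Section SemicrossedProduct.
Variables (R : realType) (H : hilbertType R) (w : bop H) (A : set (bop H)).
Hypotheses (wu : unitary w) (A_subspace : is_subspace A) (A_closed : wstar_closed A).
Implicit Types (S : set (bop (ell2 H))) (T : bop (ell2 H)).

Lemma toeplitz_sum I (r : seq I) (P : pred I) (T : I -> bop (ell2 H)) :
  (forall i, toeplitz (T i)) -> toeplitz (\sum_(i <- r | P i) T i).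
Proof.
move=> Tt; elim/big_rec: _ => [x j i|k B _ Bt x j i]; first by case: ifP.
by rewrite !bopDE !ell2D Tt Bt; case: ifP; rewrite ?addr0.
Qed.

Lemma coef_sum n I (r : seq I) (P : pred I) (T : I -> bop (ell2 H)) :
  coef w (\sum_(i <- r | P i) T i) n = \sum_(i <- r | P i) coef w (T i) n.
Proof.
rewrite /coef -mulr_sumr; congr (_ * _); apply: bop_eqP => x.
rewrite bop_sumE /= bop_sumE.
by elim/big_rec2: _ => // i y1 y2 _ <-.
Qed.

Lemma polynomial_toeplitz : analytic_polynomials w A `<=` @toeplitz R H.
Proof.
by move=> _ [k [b [_ ->]]]; apply: toeplitz_sum => n; exact: monomial_toeplitz.
Qed.

Lemma polynomial_coef n : analytic_polynomials w A `<=` [set T | A (coef w T n)].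
Proof.
move=> _ [k [b [Ab ->]]] /=; rewrite coef_sum.
have [A0 AD] := A_subspace.
elim/big_rec: _ => [//|i B _ AB]; rewrite -[X in X + _]scale1r; apply: AD => //.
by rewrite coef_monomial//; case: ifP.
Qed.

Lemma cesaro_polynomial T k : (forall m, A (coef w T m)) ->
  analytic_polynomials w A (cesaro w T k).
Proof.
move=> Ac; exists k, (fun m => (1 - m%:R / k.+1%:R)%:C *: coef w T m); split => // m.
have [A0 AD] := A_subspace; rewrite -[X in A X]addr0; exact: AD.
Qed.

Lemma wstar_closure_cesaro S T : toeplitz T -> (forall k, S (cesaro w T k)) ->
  wstar_closure S T.
Proof.
move=> Tt Sc.
apply: (closed_cvg _ (@closed_closure (wstar (ell2 H)) S) _ _ (cesaro_cvg wu Tt)).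
by apply: nearW => k; exact: (@subset_closure (wstar (ell2 H))).
Qed.

Lemma semicrossed_productE :
  semicrossed_product w A = [set T | toeplitz T /\ forall m, A (coef w T m)].
Proof.
apply/seteqP; split => [T AT|T [Tt Ac]].
  split; first exact: (closure_toeplitz polynomial_toeplitz AT).
  move=> m.
  exact: (wstar_closure_min (@polynomial_coef m) (wstar_closed_coef wu A_closed) AT).
by apply: wstar_closure_cesaro => // k; exact: cesaro_polynomial.
Qed.

End SemicrossedProduct.

Theorem theorem2p9 (R : realType) (H0 : hilbertType R) (w : bop H0)
    (A : set (bop H0)) (w_unitary : unitary w)
    (A_algebra : is_unital_subalgebra A) (A_closed : wstar_closed A)
    (A_invariant : forall b : bop H0, A b -> A (w * b * adjoint w)) :
  (is_reflexive A -> is_reflexive (semicrossed_product w A)) /\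
  (is_hereditarily_reflexive A ->
   forall S : set (bop (ell2 H0)), is_subspace S -> wstar_closed S ->
     S `<=` semicrossed_product w A -> G_invariant S -> is_reflexive S).
Proof.
have [A_subspace _ _] := A_algebra.
have refl : is_reflexive A -> is_reflexive (semicrossed_product w A).
  move=> AE; apply/seteqP; split; first exact: Ref_sub.
  rewrite semicrossed_productE// => T RT; split.
    by apply: Ref_toeplitz RT => B [].
  (* Members of the product have coefficients in [A], so [Ref_coef] places that of [T] in
     [Ref A]. *)
  move=> m; rewrite AE => x; apply: (closureS _ (@Ref_coef _ _ w _ _ m x RT)).
  by move=> _ [B [_ AB] <-]; exists (coef w B m).
split=> // hered S [S0 SD] S_closed SA G_inv.
have scaleS (a : R[i]) B : S B -> S (a *: B).
  by move=> SB; rewrite -[X in S X]addr0; exact: SD.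
have St : S `<=` @toeplitz R H0 by move=> B /SA; rewrite semicrossed_productE// => -[].
apply/seteqP; split; first exact: Ref_sub.
move=> T RT.
(* [Ref] is monotone, and hereditary reflexivity applied to [A] itself gives the first claim. *)
have : semicrossed_product w A T.
  rewrite refl; last exact: hered.
  move=> x; apply: (closureS _ (RT x)) => _ [B SB <-]; exists B => //; exact: SA.
rewrite semicrossed_productE// => -[Tt Ac].
have S_monomial m : S (monomial w m (coef w T m)).
  pose Sm := [set b | A b /\ S (monomial w m b)].
  have Sm_subspace : is_subspace Sm.
    have [A0 AD] := A_subspace; split.
      split => //; rewrite /monomial (_ : rho 0 = 0) ?mulr0//.
      by apply: bop_eqP => x; exact: rho0.
    move=> a b c [Ab Sb] [Ac' Sc]; split; first exact: AD.
    by rewrite monomialD monomialZ; exact: SD.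
  have Sm_closed : wstar_closed Sm.
    by apply: (@closedI (wstar H0)) => //; exact: wstar_closed_monomial.
  have SmE : is_reflexive Sm by apply: hered => // b [].
  suff : Sm (coef w T m) by case.
  (* It remains to see that the m-th coefficient of each member of [S] lies in [Sm]; its monomial is
     a Fourier coefficient, so G-invariance applies. *)
  rewrite SmE => x; apply: (closureS _ (@Ref_coef _ _ w _ _ m x RT)) => _ [B SB <-].
  exists (coef w B m) => //; split.
    by have := SA _ SB; rewrite semicrossed_productE// => -[_].
  by rewrite -fourier_coef_toeplitz//; [exact: G_inv|exact: St].
(* The Cesaro means of [T] are linear combinations of its monomials, all in [S]. *)
have /closure_id -> := S_closed.
apply: (wstar_closure_cesaro w_unitary Tt) => k; rewrite /cesaro.
elim/big_rec: _ => // m B _ SB; rewrite monomialZ; exact: SD.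
Qed.
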